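(* There exists a complex Banach space $X$ such that $X^{**}$ is isometrically isomorphic (as a Banach space) to a $C^*$-algebra, $n(X)=1$ and $n(X^* )=1/2$.
   Context: For a complex Banach space $X$ with dual $X^*$, bidual $X^{**}$ and unit sphere $S_X$, let $L(X)$ be the space of bounded linear operators on $X$. The numerical range of $T\in L(X)$ is $V(T)=\{x^*(Tx) : x\in S_X,\ x^*\in S_{X^*},\ x^*(x)=1\}$, the numerical radius is $v(T)=\sup\{|\lambda| : \lambda\in V(T)\}$, and the numerical index of $X$ is $n(X)=\inf\{v(T) : T\in L(X),\ \|T\|=1\}$. *)

(* Defs.v *)
From HB Require Import structures.
From mathcomp Require Import all_boot all_order all_algebra complex.
From mathcomp Require Import all_classical all_reals topology normedtype.

Set Implicit Arguments.
Unset Strict Implicit.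
Unset Printing Implicit Defensive.

Import Order.TTheory GRing.Theory Num.Theory.
Import numFieldNormedType.Exports.

Local Open Scope classical_set_scope.
Local Open Scope ring_scope.
Local Open Scope complex_scope.

(* The norm of a normed module over R[i] takes its values in R[i]; [rnorm] is
   the same norm read in R (see [rnormE]), so that suprema can be taken in R.
   The scalar field, seen as a normed space over itself, is R[i]^o. *)
Definition rnorm (R : realType) (V : normedModType R[i]) (x : V) : R :=
  complex.Re `|x|.

Section rnorm_theory.
Context {R : realType} {V : normedModType R[i]}.
Implicit Types x y : V.

Lemma rnormE x : (rnorm x)%:C = `|x|.
Proof. by rewrite /rnorm RRe_real// normr_real. Qed.

Lemma rnorm_ge0 x : 0 <= rnorm x.
Proof. by rewrite -lecR rnormE normr_ge0. Qed.

Lemma ler_rnormD x y : rnorm (x + y) <= rnorm x + rnorm y.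
Proof. by rewrite -lecR rmorphD /= !rnormE ler_normD. Qed.

Lemma rnormZ (a : R[i]) x : rnorm (a *: x) = rnorm (a : R[i]^o) * rnorm x.
Proof. by apply: complexI; rewrite rmorphM /= !rnormE normrZ. Qed.

Lemma rnorm_eq0 x : rnorm x = 0 -> x = 0.
Proof. by move=> x0; apply/eqP; rewrite -normr_eq0 -rnormE x0. Qed.

Lemma rnorm0 : rnorm (0 : V) = 0.
Proof. by rewrite /rnorm normr0. Qed.

End rnorm_theory.

Section bounded_operators.
Context {R : realType} (V W : normedModType R[i]).

Definition is_bop : {pred V -> W} :=
  fun f => `[< linear f /\ continuous f >].

Lemma is_bopP (f : V -> W) : reflect (linear f /\ continuous f) (f \in is_bop).
Proof. exact: asboolP. Qed.

Record bop := Bop { bop_fun :> V -> W ; _ : bop_fun \in is_bop }.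

HB.instance Definition _ := [isSub for bop_fun].
HB.instance Definition _ := [Choice of bop by <:].

Lemma is_bop_submod_closed : submod_closed is_bop.
Proof.
split=> [|a f g /is_bopP[lf cf] /is_bopP[lg cg]]; apply/is_bopP.
  split=> [b x y|]; last by move=> x; exact: cvg_cst.
  by rewrite -[RHS]/(b *: 0 + 0) scaler0 addr0.
split=> [b x y|x].
  rewrite -[LHS]/(a *: f (b *: x + y) + g (b *: x + y)).
  rewrite -[RHS]/(b *: (a *: f x + g x) + (a *: f y + g y)).
  rewrite lf lg !scalerDr !scalerA [b * a]mulrC -!addrA; congr (_ + _).
  by rewrite addrCA.
by apply: cvgD; [apply: cvgZr; exact: cf | exact: cg].
Qed.

HB.instance Definition _ :=
  GRing.isSubmodClosed.Build _ _ is_bop is_bop_submod_closed.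
HB.instance Definition _ := [SubChoice_isSubLmodule of bop by <:].

Lemma bop_linear (f : bop) : linear f.
Proof. by case: f => f /= /is_bopP[]. Qed.

HB.instance Definition _ (f : bop) :=
  GRing.isLinear.Build R[i] V W *:%R f (bop_linear f).

Lemma bop_continuous (f : bop) : continuous f.
Proof. by case: f => f /= /is_bopP[]. Qed.

Definition opnorm (f : bop) : R :=
  sup [set rnorm (f x) | x in [set x : V | rnorm x <= 1]].

Lemma opnorm_has_sup (f : bop) :
  has_sup [set rnorm (f x) | x in [set x : V | rnorm x <= 1]].
Proof.
split; first by exists (rnorm (f 0)), 0 => //=; rewrite rnorm0.
have /(linear_bounded_continuous (f : {linear V -> W})).2 := @bop_continuous f.
move=> /bounded_funP /(_ 1) [M Mf]; exists (complex.Re M) => _ [x x1 <-].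
have: `|f x| <= M by apply: Mf; rewrite -rnormE lecR.
by rewrite lecE => /andP[].
Qed.

Lemma opnorm_ge0 (f : bop) : 0 <= opnorm f.
Proof.
apply: le_trans (rnorm_ge0 (f 0)) _; apply: ub_le_sup.
  exact: (opnorm_has_sup f).2.
by exists 0 => //=; rewrite rnorm0.
Qed.

Lemma le_opnorm (f : bop) (x : V) : rnorm (f x) <= opnorm f * rnorm x.
Proof.
have [->|x0] := eqVneq x 0; first by rewrite linear0 !rnorm0 mulr0.
have nx0 : 0 < rnorm x.
  rewrite lt_def rnorm_ge0 andbT; apply: contra x0 => /eqP.
  by move=> /rnorm_eq0 ->.
have ninv : rnorm ((rnorm x)^-1%:C : R[i]^o) = (rnorm x)^-1.
  apply: complexI; rewrite rnormE ger0_norm// ler0c invr_ge0.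
  exact: rnorm_ge0.
rewrite -ler_pdivrMr// mulrC -[in X in X * _]ninv -rnormZ -linearZ.
apply: ub_le_sup; first exact: (opnorm_has_sup f).2.
by exists ((rnorm x)^-1%:C *: x) => //=; rewrite rnormZ ninv mulVf// gt_eqF.
Qed.

Lemma opnorm_le (f : bop) (M : R) : 0 <= M ->
  (forall x, rnorm (f x) <= M * rnorm x) -> opnorm f <= M.
Proof.
move=> M0 Mf; apply: ge_sup; first exact: (opnorm_has_sup f).1.
by move=> _ [x x1 <-]; apply: le_trans (Mf x) _; rewrite ler_piMr.
Qed.

Lemma ler_opnormD (f g : bop) : (opnorm (f + g))%:C <= (opnorm f)%:C + (opnorm g)%:C.
Proof.
rewrite -rmorphD /= lecR; apply: opnorm_le => [|x].
  by rewrite addr_ge0 ?opnorm_ge0.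
rewrite -[(f + g) x]/(f x + g x); apply: le_trans (ler_rnormD _ _) _.
by rewrite mulrDl lerD ?le_opnorm.
Qed.

Let opnormZ_le (a : R[i]) (f : bop) :
  opnorm (a *: f) <= rnorm (a : R[i]^o) * opnorm f.
Proof.
apply: opnorm_le => [|x]; first by rewrite mulr_ge0 ?rnorm_ge0 ?opnorm_ge0.
rewrite -[(a *: f) x]/(a *: f x) rnormZ -mulrA.
by rewrite ler_wpM2l ?rnorm_ge0 ?le_opnorm.
Qed.

Lemma opnormZ (a : R[i]) (f : bop) :
  (opnorm (a *: f))%:C = `|a| * (opnorm f)%:C.
Proof.
rewrite -[`|a|](rnormE (a : R[i]^o)) -rmorphM /=; congr (_%:C).
apply/le_anti/andP; split; first exact: opnormZ_le.
have [->|a0] := eqVneq a 0; first by rewrite rnorm0 mul0r opnorm_ge0.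
have na0 : rnorm (a : R[i]^o) != 0.
  by apply: contra a0 => /eqP /rnorm_eq0 ->.
have := opnormZ_le a^-1 (a *: f); rewrite scalerA mulVf// scale1r.
suff -> : rnorm (a^-1 : R[i]^o) = (rnorm (a : R[i]^o))^-1.
  by rewrite ler_pdivlMl// lt_def na0 rnorm_ge0.
by apply: complexI; rewrite fmorphV /= !rnormE normfV.
Qed.

Lemma opnorm_eq0 (f : bop) : (opnorm f)%:C = 0 -> f = 0.
Proof.
move=> /complexI f0; apply/val_inj/funext => x; apply: rnorm_eq0.
by apply/le_anti; rewrite rnorm_ge0 (le_trans (le_opnorm f x))// f0 mul0r.
Qed.

HB.instance Definition _ := Lmodule_isNormed.Build R[i] bop
  ler_opnormD opnormZ opnorm_eq0.

End bounded_operators.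

Definition dual (R : realType) (X : normedModType R[i]) : normedModType R[i] :=
  bop X R[i]^o.

Section numerical_index.
Context {R : realType} (X : normedModType R[i]).

Definition numerical_range (T : bop X X) : set R[i] :=
  [set z | exists (x : X) (f : dual X),
    [/\ `|x| = 1, `|f| = 1, f x = 1 & z = f (T x)]].

Definition numerical_radius (T : bop X X) : R :=
  sup [set rnorm (z : R[i]^o) | z in numerical_range T].

(* On R, [sup] and [inf] are junk (0) on empty or unbounded sets. If X is
   nonzero, the sets above and below are nonempty and bounded on the relevant
   side, so the values are the usual ones; the zero space gets index 0. *)
Definition numerical_index : R :=
  inf [set numerical_radius T | T in [set T : bop X X | `|T| = 1]].

End numerical_index.

(* C*-algebras need not have a unit, hence are not built on top of the ring
   structures, which all have one. *)
HB.mixin Record isCstarAlgebra (R : realType) A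
    & CompleteNormedModule R[i] A := {
  cmul : A -> A -> A ;
  cstar : A -> A ;
  cmulA : associative cmul ;
  cmulDl : left_distributive cmul +%R ;
  cmulDr : right_distributive cmul +%R ;
  cmulZl : forall (a : R[i]) (x y : A), cmul (a *: x) y = a *: cmul x y ;
  cmulZr : forall (a : R[i]) (x y : A), cmul x (a *: y) = a *: cmul x y ;
  cnormM : forall x y : A, `|cmul x y| <= `|x| * `|y| ;
  cstarK : involutive cstar ;
  cstarD : {morph cstar : x y / x + y} ;
  cstarZ : forall (a : R[i]) (x : A), cstar (a *: x) = a^* *: cstar x ;
  cstarM : forall x y : A, cstar (cmul x y) = cmul (cstar y) (cstar x) ;
  cnorm_star : forall x : A, `|cmul (cstar x) x| = `|x| ^+ 2
}.

#[short(type="cstarAlgebraType")]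
HB.structure Definition CstarAlgebra (R : realType) :=
  {A of CompleteNormedModule R[i] A & isCstarAlgebra R A}.

Definition isometrically_isomorphic (R : realType)
    (V W : normedModType R[i]) : Prop :=
  exists f : {linear V -> W}, bijective f /\ forall x, `|f x| = `|x|.

(* Main.v *)
From HB Require Import structures.
Require Import Defs.
From mathcomp Require Import all_boot all_order all_algebra complex.
From mathcomp Require Import sesquilinear spectral.
From mathcomp Require Import all_classical all_reals topology normedtype.
From mathcomp Require Import sequences lra ring.

Set Implicit Arguments.
Unset Strict Implicit.
Unset Printing Implicit Defensive.

Import Order.TTheory GRing.Theory Num.Theory.
Import numFieldNormedType.Exports.

Local Open Scope classical_set_scope.
Local Open Scope ring_scope.
Local Open Scope sesquilinear_scope.
Local Open Scope complex_scope.

(* Let E be M_2(C) with the operator norm, and let (w_n) be a sequence of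
   functionals B |-> <u_n B, v_n> / (|u_n| |v_n|) in which every pair of nonzero
   Gaussian integer vectors occurs infinitely often. Let X consist of the
   sequences x for which x_n - w_n(B) tends to 0 for some B in E, with the sup
   norm. Since B is determined by x and |B| <= |x|, X contains c_0 as an M-ideal
   with quotient E, so that X' is the l^1-sum of l^1 and E', and X'' is the
   l^oo-sum of l^oo and M_2(C), a C*-algebra.

   n(X) = 1: every coordinate of a norming vector x of T can be moved to the unit
   circle inside X without decreasing |(T x)_n|, and then the functional
   y |-> conj(x_n) y_n shows that the numerical radius of T is its norm.

   n(X') <= 1/2: take the transpose of multiplication by the nilpotent matrix
   unit N, using |1 + s l N| <= 1 + s/2 + s^2/2 for |l| = 1.

   n(X') >= 1/2: an operator S on X' nearly attains its norm at some x in X. By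
   singular value decomposition x can be replaced with a unitary U of X'', and
   the value of the functional U o S, a pair (b, B), at the pure states rotated by
   U is in the numerical range of S. Polarization loses a factor at most 2. *)

(** * Complex numbers *)

Section modulus.
Context {R : realType}.
Local Notation C := R[i]^o.
Implicit Types z w : C.

Lemma rnormM z w : rnorm (z * w : C) = rnorm z * rnorm w.
Proof. exact: rnormZ. Qed.

Lemma rnorm_real (r : R) : rnorm (r%:C : C) = `|r|.
Proof. by rewrite /rnorm normc_def /= expr0n addr0 sqrtr_sqr. Qed.

Lemma rnorm_conj z : rnorm (z^*%C : C) = rnorm z.
Proof. by rewrite /rnorm normcJ. Qed.

Lemma rnorm1 : rnorm (1 : C) = 1.
Proof. by rewrite /rnorm normr1. Qed.

Lemma rnormN (V : normedModType R[i]) (x : V) : rnorm (- x) = rnorm x.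
Proof. by rewrite /rnorm normrN. Qed.

Lemma rnormB (V : normedModType R[i]) (x y : V) : rnorm (x - y) = rnorm (y - x).
Proof. by rewrite /rnorm distrC. Qed.

Lemma rnormV z : rnorm (z^-1 : C) = (rnorm z)^-1.
Proof. by apply: complexI; rewrite fmorphV /= !rnormE normfV. Qed.

Lemma mulc_conj z : z * z^*%C = ((rnorm z) ^+ 2)%:C.
Proof. by rewrite rmorphXn /= rnormE sqr_normc. Qed.

Lemma ler_Re_rnorm z : complex.Re z <= rnorm z.
Proof.
rewrite -lecR rnormE; apply: le_trans (normc_ge_Re z).
by rewrite lecR ler_norm.
Qed.

Lemma ler_absRe_rnorm z : `|complex.Re z| <= rnorm z.
Proof. by rewrite -lecR rnormE normc_ge_Re. Qed.

Lemma ler_absIm_rnorm z : `|complex.Im z| <= rnorm z.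
Proof.
case: z => a b; rewrite /rnorm normc_def /=.
by rewrite -sqrtr_sqr ler_wsqrtr// lerDr sqr_ge0.
Qed.

Lemma rnorm_le_ReIm z : rnorm z <= `|complex.Re z| + `|complex.Im z|.
Proof.
case: z => a b; rewrite /rnorm normc_def /=.
rewrite -[leRHS]ger0_norm ?addr_ge0// -sqrtr_sqr ler_wsqrtr//.
by rewrite sqrrD !real_normK ?num_real// -addrA lerD2l lerDr mulrn_wge0// mulr_ge0.
Qed.

(* The value [1] at [0] makes the phase unimodular everywhere. *)
Definition phase z : C := if z == 0 then 1 else z^*%C / (rnorm z)%:C.

Lemma rnorm_gt0 (V : normedModType R[i]) (x : V) : (0 < rnorm x) = (x != 0).
Proof.
rewrite lt_def rnorm_ge0 andbT; congr (~~ _); apply/eqP/eqP => [/rnorm_eq0//|->].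
exact: rnorm0.
Qed.

Lemma rnorm_phase z : rnorm (phase z) = 1.
Proof.
rewrite /phase; case: eqVneq => [_|z0]; first exact: rnorm1.
rewrite rnormM rnormV rnorm_conj rnorm_real ger0_norm ?rnorm_ge0//.
by rewrite divff// gt_eqF// rnorm_gt0.
Qed.

Lemma phaseM z : phase z * z = (rnorm z)%:C.
Proof.
rewrite /phase; case: eqVneq => [->|z0]; first by rewrite mulr0 rnorm0.
rewrite mulrAC [_^* * _]mulrC mulc_conj expr2 rmorphM /= mulfK//.
by rewrite -(rmorph0 (real_complex R)) (inj_eq (@complexI R)) gt_eqF// rnorm_gt0.
Qed.

(** Turning [t] onto the ray of [a] makes the triangle inequality an equality; since [phase] is
    unimodular at 0 too, [a] and [t] may vanish. This supplies the unimodular coordinate in the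
    computation of n(X). *)
Lemma phase_align (a t : C) :
  exists2 l : C, rnorm l = 1 & rnorm (a + l * t) = rnorm a + rnorm t.
Proof.
exists ((phase a)^-1 * phase t).
  by rewrite rnormM rnormV !rnorm_phase invr1 mulr1.
have pa0 : phase a != 0 by rewrite -rnorm_gt0 rnorm_phase.
have -> : a + (phase a)^-1 * phase t * t = (phase a)^-1 * (rnorm a + rnorm t)%:C.
  by rewrite -mulrA phaseM rmorphD /= -(phaseM a) mulrDr mulKf.
by rewrite rnormM rnormV rnorm_phase invr1 mul1r rnorm_real ger0_norm// addr_ge0 ?rnorm_ge0.
Qed.

(** A positive element of [R[i]] is real, so the tolerances may be taken in [R]. *)
Lemma cvg_rnormP (T : Type) (F : set_system T) (FF : Filter F)
    (V : normedModType R[i]) (f : T -> V) (l : V) :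
  f @ F --> l <-> forall e : R, 0 < e -> \forall t \near F, rnorm (l - f t) <= e.
Proof.
split=> [/cvgrPdist_le + e e0|H].
  move=> /(_ e%:C); rewrite ltcR => /(_ e0); apply: filterS => t.
  by rewrite -rnormE lecR.
apply/cvgrPdist_le => e e0; have er : e = (complex.Re e)%:C.
  by rewrite RRe_real// gtr0_real.
move: e0; rewrite er ltcR => /H; apply: filterS => t.
by rewrite -rnormE lecR.
Qed.

Lemma cvg_ReIm (T : Type) (F : set_system T) (FF : Filter F) (f : T -> C) (a b : R) :
  (fun t => complex.Re (f t)) @ F --> a ->
  (fun t => complex.Im (f t)) @ F --> b ->
  f @ F --> (a +i* b : C).
Proof.
move=> /cvgrPdist_le fa /cvgrPdist_le fb; apply/cvg_rnormP => e e0.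
have e20 : 0 < e / 2 by rewrite divr_gt0.
near=> t; apply: le_trans (rnorm_le_ReIm _) _.
rewrite [leRHS](splitr e) lerD//=.
- have -> : complex.Re ((a +i* b : C) - f t) = a - complex.Re (f t) by case: (f t).
  by near: t; exact: fa.
- have -> : complex.Im ((a +i* b : C) - f t) = b - complex.Im (f t) by case: (f t).
  by near: t; exact: fb.
Unshelve. all: by end_near. Qed.

(** Real and imaginary parts are 1-Lipschitz, so both image filters are Cauchy in [R]. *)
Lemma C_complete (F : set_system C) : ProperFilter F -> cauchy F -> cvg F.
Proof.
move=> FF /cauchy_ballP cF.
have cp (p : C -> R) (hp : forall x y, `|p x - p y| <= rnorm (x - y)) :
    cvg (p @ F).
  apply: cauchy_cvg; apply/cauchy_ballP => e e0.
  rewrite near_map2.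
  have : 0 < e%:C by rewrite ltcR.
  move=> /cF; apply: filterS => -[x y] /=.
  rewrite -!ball_normE /= -rnormE ltcR; exact: le_lt_trans.
have cRe : cvg (@complex.Re R @ F).
  apply: cp => x y; apply: le_trans (ler_absRe_rnorm _).
  by case: x y => [? ?] [? ?].
have cIm : cvg (@complex.Im R @ F).
  apply: cp => x y; apply: le_trans (ler_absIm_rnorm _).
  by case: x y => [? ?] [? ?].
apply/cvg_ex; exists (lim (@complex.Re R @ F) +i* lim (@complex.Im R @ F)).
exact: (@cvg_ReIm _ F _ id).
Qed.

End modulus.

Lemma cvg_series_rnorm (R : realType) (u : nat -> R[i]^o) (v : nat -> R) :
  (forall n, rnorm (u n) <= v n) -> cvgn (series v) -> cvgn (series u).
Proof.
move=> uv /cauchy_cvgP/cauchy_seriesP cv.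
apply: C_complete; apply/cauchy_seriesP => e e0.
have er : e = (complex.Re e)%:C by rewrite RRe_real// gtr0_real.
move: e0; rewrite er ltcR => /cv; apply: filterS => n /= vn.
apply: le_lt_trans (ler_norm_sum _ _ _) _.
under eq_bigr => k _ do rewrite -rnormE.
rewrite -rmorph_sum ltcR; apply: le_lt_trans vn.
by apply: le_trans (ler_norm _); apply: ler_sum.
Qed.

(** * Closed subspaces of bounded functions *)

Section bounded_functions.
Context {R : realType} (I : Type).
Local Notation C := R[i]^o.

(** The closed subspaces of l^oo(I), described by a predicate; both X and the C*-algebra are
    instances. The point [usub_pt] keeps the set of values nonempty, so that the supremum in [unorm]
    is genuine. *)
Record usub := USub {
  upred :> {pred I -> C};
  usub_submod : submod_closed upred;
  usub_pt : I;
  usub_bounded : forall f, f \in upred -> exists M : R, forall i, rnorm (f i) <= M;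
  usub_closed : forall f : I -> C,
    (forall e : R, 0 < e -> exists2 g, g \in upred & forall i, rnorm (f i - g i) <= e) ->
    f \in upred }.

Variable P : usub.

Record uspace := USpace { ufun :> I -> C ; _ : ufun \in upred P }.

HB.instance Definition _ := [isSub for ufun].
HB.instance Definition _ := [Choice of uspace by <:].
HB.instance Definition _ :=
  GRing.isSubmodClosed.Build _ _ (upred P) (usub_submod P).
HB.instance Definition _ := [SubChoice_isSubLmodule of uspace by <:].

Implicit Types f g : uspace.

Lemma ufunD f g i : (f + g) i = f i + g i. Proof. by []. Qed.
Lemma ufunZ a f i : (a *: f) i = a * f i. Proof. by []. Qed.
Lemma ufunB f g i : (f - g) i = f i - g i. Proof. by []. Qed.

Lemma ufun_inj f g : f =1 g -> f = g.
Proof. by move=> fg; apply/val_inj/funext. Qed.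

Definition unorm f : R := sup [set rnorm (f i) | i in setT].

Lemma unorm_has_sup f : has_sup [set rnorm (f i) | i in setT].
Proof.
split; first by exists (rnorm (f (usub_pt P))), (usub_pt P).
have [M fM] := usub_bounded (valP f).
by exists M => _ [i _ <-]; exact: fM.
Qed.

Lemma le_unorm f i : rnorm (f i) <= unorm f.
Proof. by apply: ub_le_sup; [exact: (unorm_has_sup f).2|exists i]. Qed.

Lemma unorm_le f (M : R) : (forall i, rnorm (f i) <= M) -> unorm f <= M.
Proof.
by move=> fM; apply: ge_sup; [exact: (unorm_has_sup f).1|move=> _ [i _ <-]].
Qed.

Lemma unorm_ge0 f : 0 <= unorm f.
Proof. exact: le_trans (rnorm_ge0 _) (le_unorm f (usub_pt P)). Qed.

Lemma ler_unormD f g : (unorm (f + g))%:C <= (unorm f)%:C + (unorm g)%:C.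
Proof.
rewrite -rmorphD /= lecR; apply: unorm_le => i.
by apply: le_trans (ler_rnormD _ _) _; rewrite lerD// le_unorm.
Qed.

Let unormZ_le (a : R[i]) f : unorm (a *: f) <= rnorm (a : C) * unorm f.
Proof.
apply: unorm_le => i; rewrite ufunZ rnormM.
by rewrite ler_wpM2l ?rnorm_ge0 ?le_unorm.
Qed.

Lemma unormZ (a : R[i]) f : (unorm (a *: f))%:C = `|a| * (unorm f)%:C.
Proof.
rewrite -[`|a|](rnormE (a : C)) -rmorphM /=; congr (_%:C).
apply/le_anti/andP; split; first exact: unormZ_le.
have [->|a0] := eqVneq a 0; first by rewrite rnorm0 mul0r unorm_ge0.
have := unormZ_le a^-1 (a *: f); rewrite scalerA mulVf// scale1r.
by rewrite rnormV ler_pdivlMl// rnorm_gt0.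
Qed.

Lemma unorm_eq0 f : (unorm f)%:C = 0 -> f = 0.
Proof.
move=> /complexI f0; apply: ufun_inj => i; apply: rnorm_eq0.
by apply/le_anti; rewrite rnorm_ge0 -f0 le_unorm.
Qed.

HB.instance Definition _ := Lmodule_isNormed.Build R[i] uspace
  ler_unormD unormZ unorm_eq0.

Lemma ler_ufun f i : rnorm (f i) <= rnorm f.
Proof. exact: le_unorm. Qed.

Lemma rnorm_ufun_le f (M : R) : (forall i, rnorm (f i) <= M) -> rnorm f <= M.
Proof. exact: unorm_le. Qed.

(** The pointwise limit exists by completeness of the scalars, the Cauchy property makes the
    convergence uniform, and closedness puts the limit back in the subspace. *)
Lemma uspace_complete (F : set_system uspace) :
  ProperFilter F -> cauchy F -> cvg F.
Proof.
move=> FF /cauchy_ballP cF.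
have cl i : cvg ((fun f : uspace => f i) @ F).
  apply: C_complete; apply/cauchy_ballP => e e0; rewrite near_map2.
  apply: filterS (cF e e0) => -[f g]; rewrite -!ball_normE /= => fge.
  by apply: le_lt_trans fge; rewrite -!rnormE lecR -ufunB ler_ufun.
pose l i := lim ((fun f : uspace => f i) @ F).
pose close (e : R) (f : uspace) := forall i, rnorm (l i - f i) <= e.
have lF (e : R) : 0 < e -> \forall f \near F, close e f.
  move=> e0; have e20 : 0 < e / 2 by rewrite divr_gt0.
  (* The auxiliary [g] may depend on [i], while [f] may not: this is what gives uniformity. *)
  near=> f => i; near F => g.
  rewrite [leRHS](splitr e).
  have -> : l i - f i = (l i - g i) + (g i - f i) by rewrite subrKA.
  apply: le_trans (ler_rnormD _ _) _; apply: lerD.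
    near: g.
    by have /cvg_rnormP/(_ _ e20) := cl i.
  rewrite -ufunB; apply: le_trans (ler_ufun _ _) _.
  rewrite rnormB.
  suff : ball f (e / 2)%:C g.
    by rewrite -ball_normE /= -rnormE ltcR => /ltW.
  near: g; near: f; apply: nearP_dep; apply: cF.
  by rewrite ltcR.
have lP : l \in upred P.
  apply: usub_closed => e e0.
  have /filter_ex[f fl] := lF e e0.
  by exists f; [exact: valP|exact: fl].
apply/cvg_ex; exists (USpace lP); apply/cvg_rnormP => e e0.
apply: filterS (lF e e0) => f fl.
by apply: rnorm_ufun_le => i; rewrite ufunB.
Unshelve. all: by end_near. Qed.

HB.instance Definition _ := Uniform_isComplete.Build uspace uspace_complete.

End bounded_functions.

Section bop_build.
Context {R : realType} {V W : normedModType R[i]}.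

Lemma is_bop_bounded (f : V -> W) (M : R) :
  linear f -> (forall x, rnorm (f x) <= M * rnorm x) -> f \in @is_bop R V W.
Proof.
move=> lf fM; apply/is_bopP; split=> //.
pose g : {linear V -> W} := HB.pack f (GRing.isLinear.Build R[i] V W *:%R f lf).
apply: (linear_bounded_continuous g).1.
apply/linear_boundedP => //; near=> r => x.
have : M%:C * `|x| <= r * `|x|.
  apply: ler_wpM2r => //; near: r; apply: nbhs_pinfty_ge.
  by apply/complex_realP; exists M.
apply: le_trans; rewrite -!rnormE -rmorphM lecR; exact: fM.
Unshelve. all: by end_near. Qed.

End bop_build.

(** * Matrices as operators on row vectors *)

(** The standard inner product, linear in the first argument and conjugate linear in the second.
    Matrices act on row vectors from the right. *)
HB.lock Definition dot (R : realType) (n : nat) (u v : 'rV[R[i]]_n) : R[i]^o :=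
  dotmx u v.

HB.lock Definition vnorm (R : realType) (n : nat) (u : 'rV[R[i]]_n) : R :=
  Num.sqrt (complex.Re (dot u u)).

Section dot.
Context {R : realType} {n : nat}.
Local Notation C := R[i]^o.
Implicit Types (u v w : 'rV[R[i]]_n) (A B : 'M[R[i]]_n) (a : R[i]).

Lemma dotDl u v w : dot (u + v) w = dot u w + dot v w.
Proof. by rewrite dot.unlock linearDl. Qed.

Lemma dotDr u v w : dot u (v + w) = dot u v + dot u w.
Proof. by rewrite dot.unlock linearDr. Qed.

Lemma dotZl a u v : dot (a *: u) v = a * dot u v.
Proof. by rewrite dot.unlock linearZl_LR. Qed.

Lemma dotZr a u v : dot u (a *: v) = a^*%C * dot u v.
Proof. by rewrite dot.unlock linearZr_LR. Qed.

Lemma dotC u v : dot u v = (dot v u)^*%C.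
Proof. by rewrite dot.unlock hermC expr0 mul1r. Qed.

Lemma dot0l v : dot 0 v = 0.
Proof. by rewrite -[0](scale0r 0) dotZl mul0r. Qed.

Lemma dot0r v : dot v 0 = 0.
Proof. by rewrite dotC dot0l conjc0. Qed.

Lemma dotNl u v : dot (- u) v = - dot u v.
Proof. by rewrite -scaleN1r dotZl mulN1r. Qed.

Lemma dotNr u v : dot u (- v) = - dot u v.
Proof. by rewrite dotC dotNl rmorphN /= [in RHS]dotC. Qed.

Lemma dotE u v : dot u v = \sum_j u 0 j * (v 0 j)^*%C.
Proof. by rewrite dot.unlock dotmxE mxE; apply: eq_bigr => j _; rewrite !mxE. Qed.

Lemma dot_mulmx u v B : dot (u *m B) v = dot u (v *m (B^t* )).
Proof.
by rewrite dot.unlock !dotmxE trmx_mul map_mxM /= trmxCK mulmxA.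
Qed.

Lemma dot_delta i j B : dot (delta_mx 0 i *m B) (delta_mx 0 j) = B i j.
Proof.
rewrite dotE -rowE (bigD1 j)//= big1 => [|k kj]; rewrite !mxE !eqxx.
  by rewrite andbT conjc_nat mulr1 addr0.
by rewrite (negPf kj) conjc_nat mulr0.
Qed.

Lemma vnorm_ge0 u : 0 <= vnorm u. Proof. by rewrite vnorm.unlock; exact: sqrtr_ge0. Qed.

Lemma dotuu u : dot u u = ((vnorm u) ^+ 2)%:C.
Proof.
have u0 : 0 <= dot u u by rewrite dot.unlock; exact: dnorm_ge0.
have er : dot u u = (complex.Re (dot u u))%:C by rewrite RRe_real// ger0_real.
by rewrite vnorm.unlock sqr_sqrtr -?er// -ler0c -er.
Qed.

Lemma vnorm_sqr u : vnorm u ^+ 2 = \sum_j rnorm (u 0 j : C) ^+ 2.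
Proof.
apply: complexI; rewrite -(dotuu u) dotE rmorph_sum.
by apply: eq_bigr => j _; rewrite mulc_conj.
Qed.

Lemma vnorm_eq0 u : vnorm u = 0 -> u = 0.
Proof.
move=> u0; apply/eqP; rewrite -(dnorm_eq0 (@dotmx _ _)); apply/eqP.
by have := dotuu u; rewrite dot.unlock u0 expr0n.
Qed.

Lemma vnorm0 : vnorm (0 : 'rV[R[i]]_n) = 0.
Proof. by rewrite vnorm.unlock dot0l sqrtr0. Qed.

Lemma vnorm_gt0 u : (0 < vnorm u) = (u != 0).
Proof.
rewrite lt_def vnorm_ge0 andbT; congr (~~ _).
by apply/eqP/eqP => [/vnorm_eq0//|->]; exact: vnorm0.
Qed.

Lemma vnormZ a u : vnorm (a *: u) = rnorm (a : C) * vnorm u.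
Proof.
apply/eqP; rewrite -(@eqrXn2 _ 2)//; last 2 first.
- exact: vnorm_ge0.
- by rewrite mulr_ge0 ?rnorm_ge0 ?vnorm_ge0.
apply/eqP/complexI; rewrite -(dotuu (a *: u)) dotZl dotZr mulrA.
by rewrite (mulc_conj (a : C)) dotuu -rmorphM exprMn.
Qed.

Lemma cauchy_schwarz u v : rnorm (dot u v) <= vnorm u * vnorm v.
Proof.
rewrite -ler_sqr ?nnegrE ?rnorm_ge0 ?mulr_ge0 ?vnorm_ge0//.
rewrite -lecR.
have -> : ((vnorm u * vnorm v) ^+ 2)%:C = dot u u * dot v v.
  by rewrite exprMn [LHS]rmorphM /= !dotuu.
by rewrite rmorphXn /= rnormE dot.unlock; exact: CauchySchwarz.
Qed.

Lemma vnormDsqr u v :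
  vnorm (u + v) ^+ 2 = vnorm u ^+ 2 + vnorm v ^+ 2 + 2 * complex.Re (dot u v).
Proof.
apply: complexI; rewrite -(dotuu (u + v)) dotDl !dotDr !dotuu [dot v u]dotC.
rewrite [RHS]rmorphD [in RHS]rmorphD /=.
have -> : (2 * complex.Re (dot u v))%:C = dot u v + (dot u v)^*%C.
  by rewrite addcJ [LHS]rmorphM rmorph_nat.
by rewrite [X in _ + X = _]addrC addrACA.
Qed.

Lemma vnormD u v : vnorm (u + v) <= vnorm u + vnorm v.
Proof.
rewrite -ler_sqr ?nnegrE ?addr_ge0 ?vnorm_ge0//.
rewrite vnormDsqr sqrrD addrAC lerD2r lerD2l -[leRHS]mulr_natl ler_pM2l//.
exact: le_trans (ler_Re_rnorm _) (cauchy_schwarz _ _).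
Qed.

Lemma vnormN u : vnorm (- u) = vnorm u.
Proof. by rewrite -scaleN1r vnormZ rnormN rnorm1 mul1r. Qed.

Lemma parallelogram u v :
  vnorm (u + v) ^+ 2 + vnorm (u - v) ^+ 2 = 2 * (vnorm u ^+ 2 + vnorm v ^+ 2).
Proof.
have E := vnormDsqr u (- v); rewrite dotNr vnormN in E.
rewrite [X in _ + X = _]E [X in X + _ = _]vnormDsqr.
have -> : complex.Re (- dot u v) = - complex.Re (dot u v) by case: (dot u v).
ring.
Qed.

Lemma vnorm_delta (i : 'I_n) : vnorm (delta_mx 0 i : 'rV[R[i]]_n) = 1.
Proof.
have := dot_delta i i 1%:M; rewrite mulmx1 dotuu mxE eqxx => /complexI.
by move=> /eqP; rewrite -[X in _ == X](expr1n _ 2) eqrXn2 ?vnorm_ge0// => /eqP.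
Qed.

Lemma rnorm_coord u j : rnorm (u 0 j : C) <= vnorm u.
Proof.
rewrite -ler_sqr ?nnegrE ?rnorm_ge0 ?vnorm_ge0// vnorm_sqr.
by rewrite (bigD1 j)//= lerDl sumr_ge0// => k _; rewrite sqr_ge0.
Qed.

(** For [0 <= M] this says that the operator norm of [B] is at most [M]. The form with two vectors
    matches the functionals that define X and is symmetric under adjoints. *)
Definition mxle B (M : R) :=
  forall u v, rnorm (dot (u *m B) v) <= M * (vnorm u * vnorm v).

Lemma mxleP B M : 0 <= M -> mxle B M <-> forall u, vnorm (u *m B) <= M * vnorm u.
Proof.
move=> M0; split=> [BM u|BM u v].
  have [->|uB0] := eqVneq (u *m B) 0.
    by rewrite vnorm0 mulr_ge0 ?vnorm_ge0.
  have := BM u (u *m B); rewrite dotuu rnorm_real ger0_norm ?sqr_ge0// expr2.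
  by rewrite mulrA ler_pM2r// vnorm_gt0.
apply: le_trans (cauchy_schwarz _ _) _.
by rewrite mulrA ler_wpM2r ?vnorm_ge0.
Qed.

Lemma mxle_trans B (M N : R) : M <= N -> mxle B M -> mxle B N.
Proof.
move=> MN BM u v; apply: le_trans (BM u v) _.
by rewrite ler_wpM2r ?mulr_ge0 ?vnorm_ge0.
Qed.

Lemma mxleM A B (M N : R) : 0 <= M -> 0 <= N ->
  mxle A M -> mxle B N -> mxle (A *m B) (M * N).
Proof.
move=> M0 N0 /(mxleP _ M0) AM /(mxleP _ N0) BN; apply/mxleP => [|u].
  exact: mulr_ge0.
rewrite mulmxA; apply: le_trans (BN _) _.
by rewrite [M * N]mulrC -mulrA ler_wpM2l.
Qed.

Lemma mxle_adj B (M : R) : mxle B M -> mxle (B^t* ) M.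
Proof.
move=> BM u v; rewrite dot_mulmx trmxCK dotC rnorm_conj.
by rewrite [vnorm u * _]mulrC.
Qed.

(** The nontrivial half of the C*-identity: with B' the adjoint of B, |u B'|^2 = <u B' B, u>, and B
    has the same bound as B'. *)
Lemma mxle_adjM B (M : R) : 0 <= M -> mxle ((B^t* ) *m B) (M ^+ 2) -> mxle B M.
Proof.
move=> M0 BM; rewrite -[B]trmxCK; apply/mxle_adj/mxleP => // u.
rewrite -ler_sqr ?nnegrE ?vnorm_ge0 ?mulr_ge0 ?vnorm_ge0//.
have := BM u u; rewrite mulmxA dot_mulmx dotuu rnorm_real ger0_norm ?sqr_ge0//.
by rewrite -(expr2 (vnorm u)) -(exprMn _ M).
Qed.

(** A crude bound: each of the n^2 terms of the double sum is at most e |u| |v|. *)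
Lemma mxle_entries B (e : R) : 0 <= e ->
  (forall i j, rnorm (B i j : C) <= e) -> mxle B (e * n%:R ^+ 2).
Proof.
move=> e0 Be u v; rewrite dotE.
have -> : e * n%:R ^+ 2 * (vnorm u * vnorm v) =
    \sum_(j < n) \sum_(i < n) (vnorm u * e * vnorm v).
  under eq_bigr do rewrite sumr_const card_ord -[_ *+ n]mulr_natr.
  rewrite sumr_const card_ord -[RHS]mulr_natr.
  move: (n%:R : R) (vnorm u) (vnorm v) => N x y; ring.
apply: (@big_ind2 _ _ (fun (x : C) y => rnorm x <= y)).
- by rewrite rnorm0.
- by move=> *; apply: le_trans (ler_rnormD _ _) (lerD _ _).
move=> j _; rewrite mxE -mulr_suml rnormM rnorm_conj.
apply: ler_pM; rewrite ?rnorm_ge0 ?rnorm_coord//.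
apply: (@big_ind2 _ _ (fun (x : C) y => rnorm x <= y)).
- by rewrite rnorm0.
- by move=> *; apply: le_trans (ler_rnormD _ _) (lerD _ _).
by move=> i _; rewrite rnormM ler_pM ?rnorm_ge0 ?rnorm_coord.
Qed.

Lemma mxle_exists B : exists2 M : R, 0 <= M & mxle B M.
Proof.
pose e := \sum_i \sum_j rnorm (B i j : C).
have e0 : 0 <= e by do 2!apply: sumr_ge0 => ? _; exact: rnorm_ge0.
exists (e * n%:R ^+ 2); first by rewrite mulr_ge0 ?exprn_ge0.
apply: mxle_entries => // i j.
rewrite /e (bigD1 i)//= (bigD1 j)//= -addrA lerDl addr_ge0 ?sumr_ge0// => *.
  exact: rnorm_ge0.
by apply: sumr_ge0 => *; exact: rnorm_ge0.
Qed.

(* The factor 1/2 relating the numerical radius of a matrix to its norm. *)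
Lemma polarization A B (c : R) :
  (forall w, rnorm (dot (w *m A) (w *m B)) <= c * vnorm w ^+ 2) ->
  forall u v, rnorm (dot (u *m A) (v *m B)) <= 2 * c * (vnorm u * vnorm v).
Proof.
move=> H.
pose q w : C := dot (w *m A) (w *m B).
have le1 u v : rnorm (dot (u *m A) (v *m B)) <= c * (vnorm u ^+ 2 + vnorm v ^+ 2).
  (* Polarization identity for the sesquilinear form <u A, v B>. *)
  have E : (4%:R : C) * dot (u *m A) (v *m B) =
      (q (u + v) - q (u - v)) + 'i%C * (q (u + 'i%C *: v) - q (u - 'i%C *: v)).
    have iC : ('i%C : R[i])^*%C = - 'i%C.
      by apply/eqP; rewrite eq_complex /= oppr0 !eqxx.
    rewrite /q !mulmxDl !mulNmx -!scalemxAl !(dotDl, dotDr, dotNl, dotNr).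
    rewrite !(dotZl, dotZr) iC.
    move: (dot (u *m A) (u *m B)) (dot (u *m A) (v *m B)) => x y.
    move: (dot (v *m A) (u *m B)) (dot (v *m A) (v *m B)) => z t.
    have : 'i%C * 'i%C = -1 :> R[i] by rewrite -expr2 sqr_i.
    move: ('i%C : R[i]) => k k2.
    (* The two sides agree only modulo k^2 = -1, so their difference is displayed as a multiple of
       k^2 + 1. *)
    transitivity (4%:R * y + (k * k + 1) * (2%:R * z - 2%:R * y) : R[i]); last ring.
    by rewrite k2 addNr mul0r addr0.
  have four : rnorm (4%:R : C) = 4.
    by rewrite -(rmorph_nat (real_complex R)) rnorm_real ger0_norm.
  have ri : rnorm ('i%C : C) = 1 by rewrite /rnorm normc_def /= expr0n expr1n add0r sqrtr1.
  have ri' w : vnorm ('i%C *: w) = vnorm w by rewrite vnormZ ri mul1r.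
  have : rnorm ((4%:R : C) * dot (u *m A) (v *m B)) <=
      c * (vnorm (u + v) ^+ 2 + vnorm (u - v) ^+ 2) +
      c * (vnorm (u + 'i%C *: v) ^+ 2 + vnorm (u - 'i%C *: v) ^+ 2).
    rewrite E; apply: le_trans (ler_rnormD _ _) _.
    rewrite rnormM ri mul1r; apply: lerD;
      by apply: le_trans (ler_rnormD _ _) _; rewrite rnormN mulrDr lerD// H.
  by rewrite rnormM four !parallelogram ri'; lra.
move=> u v; have [->|u0] := eqVneq u 0.
  by rewrite mul0mx dot0l rnorm0 vnorm0 mul0r mulr0.
have [->|v0] := eqVneq v 0.
  by rewrite mul0mx dot0r rnorm0 vnorm0 !mulr0.
rewrite -vnorm_gt0 in u0; rewrite -vnorm_gt0 in v0.
(* At unit vectors the right-hand side of [le1] is 2c. *)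
have := le1 ((vnorm u)^-1%:C *: u) ((vnorm v)^-1%:C *: v).
rewrite !vnormZ -!scalemxAl dotZl dotZr conjc_real !rnormM !rnorm_real.
rewrite !ger0_norm ?invr_ge0 ?vnorm_ge0// !mulVf ?gt_eqF// expr1n.
rewrite mulrA -invfM ler_pdivrMl ?mulr_gt0//; lra.
Qed.

End dot.

(** * Two-by-two matrices: the nilpotent unit and singular values *)

Section two_by_two.
Context {R : realType}.
Local Notation C := R[i]^o.
Implicit Types (u v : 'rV[R[i]]_2) (B U : 'M[R[i]]_2).

Definition shift_mx : 'M[R[i]]_2 := delta_mx 0 1.

Lemma vnorm2_sqr u : vnorm u ^+ 2 = rnorm (u 0 0 : C) ^+ 2 + rnorm (u 0 1 : C) ^+ 2.
Proof.
rewrite vnorm_sqr big_ord_recl big_ord_recl big_ord0 addr0.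
by congr (_ + rnorm (u 0 _ : C) ^+ 2); apply/val_inj.
Qed.

(** The perturbation adds s l u_0 to the second coordinate of u. By 2ab <= a^2 + b^2 the squared
    norm grows by a factor of at most 1 + s + s^2, which is below the square of the stated bound.
    The linear coefficient 1/2 is the one that bounds n(X'). *)
Lemma mxle_shift (l : C) (s : R) B : rnorm l = 1 -> 0 <= s -> mxle B 1 ->
  mxle (B + (s%:C * l) *: (shift_mx *m B)) (1 + s / 2 + s ^+ 2 / 2).
Proof.
move=> l1 s0 B1.
have -> : B + (s%:C * l) *: (shift_mx *m B) = (1%:M + (s%:C * l) *: shift_mx) *m B.
  by rewrite mulmxDl mul1mx scalemxAl.
have K0 : 0 <= 1 + s / 2 + s ^+ 2 / 2.
  by rewrite !addr_ge0// ?divr_ge0// ?sqr_ge0.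
rewrite -[X in mxle _ X]mulr1; apply: mxleM => //; apply/mxleP => // u.
rewrite mulmxDr mulmx1 -ler_sqr ?nnegrE ?mulr_ge0 ?vnorm_ge0//.
have -> : u *m ((s%:C * l) *: shift_mx) = (s%:C * l * u 0 0) *: delta_mx 0 1.
  rewrite -scalemxAr -scalerA; congr (_ *: _); apply/rowP => j.
  rewrite !mxE (bigD1 0)//= big1 => [|k k0]; rewrite !mxE ?eqxx /= ?addr0//.
  by rewrite (negPf k0) mulr0.
rewrite vnormDsqr vnormZ vnorm_delta mulr1 !rnormM l1 mulr1 rnorm_real ger0_norm//.
set z := dot _ _.
have zle : complex.Re z <= s * (rnorm (u 0 0 : C) * rnorm (u 0 1 : C)).
  apply: le_trans (ler_Re_rnorm _) _; rewrite /z dotZr rnormM rnorm_conj !rnormM.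
  rewrite l1 mulr1 rnorm_real ger0_norm//.
  have -> : dot u (delta_mx 0 1) = u 0 1.
    rewrite dotE (bigD1 1)//= big1 => [|k k0]; rewrite !mxE.
      by rewrite conjc_nat mulr1 addr0.
    by rewrite (negPf k0) andbF conjc_nat mulr0.
  by rewrite mulrA.
rewrite [leRHS]exprMn !vnorm2_sqr.
move: zle (rnorm_ge0 (u 0 0 : C)) (rnorm_ge0 (u 0 1 : C)).
move: (rnorm (u 0 0 : C)) (rnorm (u 0 1 : C)) (complex.Re z) => a b r zle a0 b0.
have ab : 2 * (a * b) <= a ^+ 2 + b ^+ 2.
  by have := sqr_ge0 (a - b); rewrite sqrrB; lra.
have t0 : 0 <= a ^+ 2 + b ^+ 2 by rewrite addr_ge0 ?sqr_ge0.
apply: (@le_trans _ _ ((1 + s + s ^+ 2) * (a ^+ 2 + b ^+ 2))).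
  have : s * (2 * (a * b)) <= s * (a ^+ 2 + b ^+ 2) by rewrite ler_wpM2l.
  have : 0 <= s ^+ 2 * b ^+ 2 by rewrite mulr_ge0 ?sqr_ge0.
  rewrite exprMn; lra.
apply: ler_wpM2r => //.
have -> : (1 + s / 2 + s ^+ 2 / 2) ^+ 2 =
    1 + s + s ^+ 2 + (s ^+ 2 / 4 + s ^+ 3 / 2 + s ^+ 4 / 4) by field.
by rewrite lerDl !addr_ge0// divr_ge0// exprn_ge0.
Qed.

Lemma unit_row (r : 'rV[R[i]]_2) : r != 0 ->
  exists q s, vnorm q = 1 /\ r = s *: q.
Proof.
move=> r0; exists ((vnorm r)^-1%:C *: r), (vnorm r)%:C; split.
  rewrite vnormZ rnorm_real ger0_norm ?invr_ge0 ?vnorm_ge0// mulVf//.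
  by rewrite gt_eqF// vnorm_gt0.
by rewrite scalerA -rmorphM divff ?scale1r// gt_eqF// vnorm_gt0.
Qed.

Lemma orthonormal_complement (q : 'rV[R[i]]_2) : vnorm q = 1 ->
  exists q', vnorm q' = 1 /\ dot q q' = 0.
Proof.
move=> q1; pose q' : 'rV[R[i]]_2 :=
  \row_j (if j == 0 then - (q 0 1)^*%C else (q 0 0)^*%C).
exists q'; split.
  apply/eqP; rewrite -(@eqrXn2 _ 2) ?vnorm_ge0// -q1 !vnorm2_sqr !mxE /=.
  by rewrite rnormN !rnorm_conj addrC.
rewrite dotE big_ord_recl big_ord_recl big_ord0 addr0 !mxE /=.
have -> : lift ord0 ord0 = 1 :> 'I_2 by apply/val_inj.
by rewrite rmorphN /= !conjcK mulrN addrC [X in X - _]mulrC subrr.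
Qed.

(** Nonzero rows are normalized; a zero row has no direction of its own and receives a unit vector
    orthogonal to the other one. *)
Lemma orthogonal_rows (r0 r1 : 'rV[R[i]]_2) : dot r0 r1 = 0 ->
  exists q0 q1 s0 s1, [/\ vnorm q0 = 1, vnorm q1 = 1, dot q0 q1 = 0,
    r0 = s0 *: q0 & r1 = s1 *: q1].
Proof.
have [->|r00] := eqVneq r0 0; have [->|r10] := eqVneq r1 0 => r01.
- have e1 := @vnorm_delta R 2 0; have [q [qn qo]] := orthonormal_complement e1.
  by exists (delta_mx 0 0), q, 0, 0; rewrite !scale0r.
- have [q [s [qn ->]]] := unit_row r10; have [q' [qn' qo]] := orthonormal_complement qn.
  by exists q', q, 0, s; rewrite scale0r; split=> //; rewrite dotC qo conjc0.
- have [q [s [qn ->]]] := unit_row r00; have [q' [qn' qo]] := orthonormal_complement qn.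
  by exists q, q', s, 0; rewrite scale0r.
have [q0 [s0 [q0n E0]]] := unit_row r00; have [q1 [s1 [q1n E1]]] := unit_row r10.
exists q0, q1, s0, s1; split => //; move: r01 r00 r10.
rewrite E0 E1 dotZl dotZr => /eqP; rewrite !mulf_eq0 conjc_eq0.
by case/or3P => /eqP // ->; rewrite scale0r eqxx.
Qed.

Lemma I2P (i : 'I_2) : i = 0 \/ i = 1.
Proof. by case: i => [[|[|//]] ?]; [left|right]; apply/val_inj. Qed.

(** The spectral theorem diagonalizes B times its adjoint by a unitary P; the rows of P B are then
    orthogonal, and normalizing them gives Q. Only the bound by 1 on the coefficients matters later,
    so they are allowed to be complex. *)
Lemma singular_value_decomposition B : mxle B 1 ->
  exists (P Q : 'M[R[i]]_2) (s0 s1 : R[i]),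
    [/\ P \is unitarymx, Q \is unitarymx, rnorm (s0 : C) <= 1,
        rnorm (s1 : C) <= 1 &
        B = s0 *: (P *m delta_mx 0 0 *m Q) + s1 *: (P *m delta_mx 1 1 *m Q)].
Proof.
move=> B1.
pose H := B *m (B^t* ).
have Hn : H \is normalmx.
  by apply/normalmxP; rewrite /H trmx_mul map_mxM /= trmxCK.
have : spectralmx H \is unitarymx by exact: spectral_unitarymx.
have /orthomx_spectralP := Hn.
move: (spectralmx H) (spectral_diag H) => P d HE Pu.
have /unitarymxP PP := Pu.
move: HE; rewrite invmx_unitary// => HE.
have [M ME] : exists M, M = P *m B by exists (P *m B).
have M01 : dot (row 0 M) (row 1 M) = 0.
  have MM : M *m (M^t* ) = diag_mx d.
    rewrite ME trmx_mul map_mxM /= mulmxA -[P *m B *m _]mulmxA -/H HE.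
    by rewrite !mulmxA PP mul1mx -mulmxA PP mulmx1.
  have : (M *m (M^t* )) 0 1 = 0 by rewrite MM !mxE /= mulr0n.
  move=> <-; rewrite dot.unlock dotmxE mxE [RHS]mxE.
  by apply: eq_bigr => k _; rewrite !mxE.
have [q0 [q1 [s0 [s1 [q0n q1n q01 E0 E1]]]]] := orthogonal_rows M01.
have [Q QE] : exists Q : 'M[R[i]]_2, forall i, row i Q = if i == 0 then q0 else q1.
  by exists (\matrix_i (if i == 0 then q0 else q1)) => i; rewrite rowK.
have Qu : Q \is unitarymx.
  apply/row_unitarymxP => i j; rewrite !QE.
  have nn q : vnorm q = 1 -> dotmx q q = 1.
    by move=> qn; have := dotuu q; rewrite dot.unlock qn expr1n.
  have q10 : dot q1 q0 = 0 by rewrite dotC q01 conjc0.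
  rewrite dot.unlock in q01 q10.
  by case: (I2P i) => ->; case: (I2P j) => -> /=; rewrite ?q01 ?q10 ?nn.
(* The modulus of [s] is the norm of a row of P B, where B is a contraction and the rows of P are
   unit vectors. *)
have sle s i q : vnorm q = 1 -> row i M = s *: q -> rnorm (s : C) <= 1.
  move=> qn E; rewrite -[rnorm _]mulr1 -qn -vnormZ -E ME row_mul.
  have /mxleP := B1 => /(_ ler01 (row i P)); rewrite mul1r => /le_trans; apply.
  have /row_unitarymxP/(_ i i) := Pu; rewrite eqxx => e.
  have := dotuu (row i P); rewrite dot.unlock e => /complexI/esym/eqP.
  by rewrite -[X in _ == X](expr1n _ 2) eqrXn2 ?vnorm_ge0// => /eqP ->; rewrite qn.
have MQ : M = s0 *: (delta_mx 0 0 *m Q) + s1 *: (delta_mx 1 1 *m Q).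
  apply/row_matrixP => i; rewrite linearD /= !linearZ /= !row_mul.
  have rd a b : row a (delta_mx b b) = (a == b)%:R *: delta_mx 0 b :> 'rV[R[i]]_2.
    apply/rowP => j; rewrite !mxE eqxx /=.
    by case: (a == b); rewrite ?mul1r ?mul0r.
  rewrite !rd -!scalemxAl -!rowE !QE.
  by case: (I2P i) => -> /=; rewrite ?scale1r ?scale0r ?scaler0 ?addr0 ?add0r.
have BP : B = (P^t* ) *m M.
  by rewrite ME mulmxA -(invmx_unitary Pu) mulVmx ?mul1mx ?unitarymx_unit.
exists (P^t* ), Q, s0, s1; split.
- by rewrite trmxC_unitary.
- exact: Qu.
- exact: sle E0.
- exact: sle E1.
by rewrite {1}BP MQ mulmxDr -!scalemxAr !mulmxA.
Qed.

Lemma diag_unitarymx (a b : R[i]) : a * a^*%C = 1 -> b * b^*%C = 1 ->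
  a *: delta_mx 0 0 + b *: delta_mx 1 1 \is @unitarymx R[i] 2 2.
Proof.
move=> a1 b1; apply/unitarymxP/matrixP => i j.
rewrite !mxE big_ord_recl big_ord_recl big_ord0 !mxE.
by case: (I2P i) => ->; case: (I2P j) => -> /=;
  rewrite !(mulr1, mulr0, addr0, add0r, rmorph0, mul0r) //.
Qed.

Lemma linear_combination2 (g : 'M[R[i]]_2 -> C) (a b : R[i]) D0 D1 :
  linear g -> g (a *: D0 + b *: D1) = a * g D0 + b * g D1.
Proof.
move=> lg; rewrite lg; congr (_ + _).
have g0 : g 0 = 0.
  have := lg 1 0 0; rewrite !scale1r addr0 => /eqP.
  by rewrite -subr_eq subrr eq_sym => /eqP.
by rewrite -[b *: _]addr0 lg g0 addr0.
Qed.

Lemma phase_combination (g : 'M[R[i]]_2 -> C) D0 D1 : linear g ->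
  g ((phase (g D0) : R[i]) *: D0 + (phase (g D1) : R[i]) *: D1) =
  (rnorm (g D0) + rnorm (g D1))%:C.
Proof. by move=> lg; rewrite linear_combination2// !phaseM rmorphD. Qed.

(* A linear functional on matrices attains at a unitary at least its value on
   the unit ball: replace the singular values by phases. *)
Lemma unitary_maximizer (g : 'M[R[i]]_2 -> C) B :
  linear g -> mxle B 1 ->
  exists U (r : R), [/\ U \is unitarymx, g U = r%:C & rnorm (g B) <= r].
Proof.
move=> lg /singular_value_decomposition[P [Q [s0 [s1 [Pu Qu s0le s1le ->]]]]].
set D0 := P *m _ *m Q; set D1 := P *m _ *m Q.
pose a : R[i] := phase (g D0); pose b : R[i] := phase (g D1).
exists (a *: D0 + b *: D1), (rnorm (g D0) + rnorm (g D1)); split.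
- have -> : a *: D0 + b *: D1 =
      P *m (a *: delta_mx 0 0 + b *: delta_mx 1 1) *m Q.
    by rewrite mulmxDr mulmxDl -!(scalemxAr _ P) -!scalemxAl.
  apply: mul_unitarymx; last exact: Qu.
  apply: mul_unitarymx; first exact: Pu.
  by apply: diag_unitarymx; rewrite /a /b (mulc_conj (phase _)) rnorm_phase expr1n.
- exact: phase_combination.
- rewrite linear_combination2//; apply: le_trans (ler_rnormD _ _) _; rewrite !rnormM.
  by apply: lerD; rewrite ler_piMl ?rnorm_ge0.
Qed.

End two_by_two.

(** * Vector functionals and the space X *)

Section vector_functionals.
Context {R : realType}.
Local Notation C := R[i]^o.
Implicit Types (u v : 'rV[R[i]]_2) (A B : 'M[R[i]]_2) (p q : 'M[int]_2).

(* Zero if [u] or [v] is, by division by zero. *)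
Definition vfun u v B : C := dot (u *m B) v / (vnorm u * vnorm v)%:C.

Lemma vfunD u v A B : vfun u v (A + B) = vfun u v A + vfun u v B.
Proof. by rewrite /vfun mulmxDr dotDl mulrDl. Qed.

Lemma vfunZ u v (a : R[i]) B : vfun u v (a *: B) = a * vfun u v B.
Proof. by rewrite /vfun -scalemxAr dotZl mulrA. Qed.

Lemma vfunN u v B : vfun u v (- B) = - vfun u v B.
Proof. by rewrite -scaleN1r vfunZ mulN1r. Qed.

Lemma vfun0 u v : vfun u v 0 = 0.
Proof. by rewrite -[0](scale0r 0) vfunZ mul0r. Qed.

Lemma rnorm_vfun u v B :
  rnorm (vfun u v B) = rnorm (dot (u *m B) v) / (vnorm u * vnorm v).
Proof.
by rewrite /vfun rnormM rnormV rnorm_real ger0_norm// mulr_ge0 ?vnorm_ge0.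
Qed.

Lemma rnorm_dot_vfun u v B :
  rnorm (dot (u *m B) v) = rnorm (vfun u v B) * (vnorm u * vnorm v).
Proof.
rewrite rnorm_vfun; have [->|u0] := eqVneq u 0.
  by rewrite mul0mx dot0l rnorm0 !mul0r.
have [->|v0] := eqVneq v 0; first by rewrite dot0r rnorm0 !mul0r.
by rewrite divfK// mulf_neq0 ?gt_eqF ?vnorm_gt0.
Qed.

Lemma rnorm_vfun_le u v B (M : R) : 0 <= M -> mxle B M -> rnorm (vfun u v B) <= M.
Proof.
move=> M0 BM; rewrite rnorm_vfun.
have [->|u0] := eqVneq u 0.
  by rewrite mul0mx dot0l rnorm0 mul0r.
have [->|v0] := eqVneq v 0; first by rewrite dot0r rnorm0 mul0r.
by rewrite ler_pdivrMr ?mulr_gt0 ?vnorm_gt0//; exact: BM.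
Qed.

(** Integer matrices form a countable type, so these vectors can be enumerated through
    [unpickle]. *)
Definition gaussian_vec p : 'rV[R[i]]_2 :=
  \row_j ((p 0 j)%:~R +i* (p 1 j)%:~R).

(** Taking floors costs at most 1 in each real and imaginary part, hence 2 per coordinate, and 2^2 +
    2^2 <= 3^2. *)
Lemma gaussian_vec_approx u :
  exists p, vnorm (u - gaussian_vec p) <= 3.
Proof.
pose p : 'M[int]_2 := \matrix_(i, j)
  if i == 0 then Num.floor (complex.Re (u 0 j)) else Num.floor (complex.Im (u 0 j)).
exists p; rewrite -ler_sqr ?nnegrE ?vnorm_ge0// vnorm2_sqr.
have c j : rnorm ((u - gaussian_vec p) 0 j : C) <= 2.
  apply: le_trans (rnorm_le_ReIm _) _; rewrite !mxE /=.
  case: (u 0 j) => a b /=.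
  have h (r : R) : `|r - (Num.floor r)%:~R| <= 1.
    rewrite ger0_norm ?subr_ge0 ?ge_floor//.
    by rewrite lerBlDl -[1]/(1%:~R) -intrD ltW// floorD1_gt.
  by rewrite -[2]/(1 + 1) lerD.
have c2 j : rnorm ((u - gaussian_vec p) 0 j : C) ^+ 2 <= 2 ^+ 2.
  by rewrite ler_sqr ?nnegrE ?rnorm_ge0.
by have := lerD (c2 0) (c2 1) => /le_trans; apply; lra.
Qed.

(** Divide by k^2 and let k grow. *)
Lemma le_of_quadratic (X Y c d : R) : 0 <= c -> 0 <= d ->
  (forall k : nat, k%:R ^+ 2 * X <= k%:R ^+ 2 * Y + k%:R * c + d) -> X <= Y.
Proof.
move=> c0 d0 H; rewrite leNgt; apply/negP => XY.
have e0 : 0 < X - Y by rewrite subr_gt0.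
pose k := (Num.truncn ((c + d) / (X - Y))).+1.
have kgt : (c + d) / (X - Y) < k%:R by exact: truncnS_gt.
rewrite ltr_pdivrMr// in kgt.
have k1 : 1 <= k%:R :> R by rewrite ler1n.
have := H k; move: (k%:R : R) kgt k1 => t tgt t1 Ht.
have : t * (c + d) < t * (t * (X - Y)) by rewrite ltr_pM2l// (lt_le_trans ltr01).
have : d <= t * d by rewrite ler_peMl.
by rewrite expr2 in Ht; lra.
Qed.

(* Scaling by [k], the error of approximating both vectors by Gaussian integer
   ones is linear in [k], while the sesquilinear form is quadratic. *)
Lemma mxle_gaussian B (M : R) : 0 <= M ->
  (forall p q, rnorm (vfun (gaussian_vec p) (gaussian_vec q) B) <= M) -> mxle B M.
Proof.
move=> M0 H u v; have [K K0 BK] := mxle_exists B.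
set a := vnorm u; set b := vnorm v.
have a0 : 0 <= a by exact: vnorm_ge0.
have b0 : 0 <= b by exact: vnorm_ge0.
(* The coefficients come from expanding M (k a + 3) (k b + 3) + 3 K (k a + 3) + 3 K k b, the sum of
   the bounds [t1], [t2] and [t3] below. *)
apply: (@le_of_quadratic _ _ (3 * (M + K) * (a + b)) (9 * (M + K))) => [||k].
- by rewrite !mulr_ge0 ?addr_ge0.
- by rewrite !mulr_ge0 ?addr_ge0.
have k0 : 0 <= k%:R :> R by [].
have [p] := gaussian_vec_approx (k%:R *: u).
set P := gaussian_vec p; set r := _ - _ => rle.
have [q] := gaussian_vec_approx (k%:R *: v).
set Q := gaussian_vec q; set s := _ - _ => sle.
have uE : k%:R *: u = P + r by rewrite addrC subrK.
have vE : k%:R *: v = Q + s by rewrite addrC subrK.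
have nk : rnorm (k%:R : C) = k%:R.
  by rewrite -(rmorph_nat (real_complex R)) rnorm_real ger0_norm.
have Ple : vnorm P <= k%:R * a + 3.
  have -> : P = k%:R *: u - r by rewrite uE addrK.
  by apply: le_trans (vnormD _ _) _; rewrite vnormN vnormZ nk lerD2l.
have Qle : vnorm Q <= k%:R * b + 3.
  have -> : Q = k%:R *: v - s by rewrite vE addrK.
  by apply: le_trans (vnormD _ _) _; rewrite vnormN vnormZ nk lerD2l.
have -> : k%:R ^+ 2 * rnorm (dot (u *m B) v) =
    rnorm (dot ((k%:R *: u) *m B) (k%:R *: v)).
  by rewrite -scalemxAl dotZl dotZr !rnormM rnorm_conj nk mulrA.
have E : dot ((k%:R *: u) *m B) (k%:R *: v) =
    dot (P *m B) Q + dot (P *m B) s + dot (r *m B) (k%:R *: v).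
  by rewrite uE mulmxDl dotDl {1}vE dotDr.
rewrite E; apply: le_trans (ler_rnormD _ _) _.
have t3 : rnorm (dot (r *m B) (k%:R *: v)) <= K * (3 * (k%:R * b)).
  apply: le_trans (BK _ _) _; rewrite vnormZ nk ler_wpM2l//.
  by rewrite ler_wpM2r ?mulr_ge0.
have t2 : rnorm (dot (P *m B) s) <= K * ((k%:R * a + 3) * 3).
  by apply: le_trans (BK _ _) _; rewrite ler_wpM2l// ler_pM ?vnorm_ge0.
have t1 : rnorm (dot (P *m B) Q) <= M * ((k%:R * a + 3) * (k%:R * b + 3)).
  rewrite rnorm_dot_vfun; apply: ler_pM; rewrite ?rnorm_ge0 ?mulr_ge0 ?vnorm_ge0//.
    exact: H.
  by rewrite ler_pM ?vnorm_ge0.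
have := le_trans (ler_rnormD (dot (P *m B) Q) (dot (P *m B) s)) (lerD t1 t2).
move: t3; move: (rnorm _) (rnorm _) (k%:R : R) => x y t; lra.
Qed.

(* Every pair of Gaussian integer vectors occurs infinitely often, since [logn 2]
   takes every value infinitely often. *)
Definition vec_pair (n : nat) : 'rV[R[i]]_2 * 'rV[R[i]]_2 :=
  if @unpickle ('M[int]_2 * 'M[int]_2)%type (logn 2 n) is Some pq
  then (gaussian_vec pq.1, gaussian_vec pq.2) else (0, 0).

Lemma vec_pair_recurrent p q (N : nat) :
  exists2 n, (N <= n)%N & vec_pair n = (gaussian_vec p, gaussian_vec q).
Proof.
(* The factor 3^N makes the index at least N without changing its 2-adic valuation, which carries
   the code of the pair. *)
exists (2 ^ pickle (p, q) * 3 ^ N)%N.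
  apply: leq_trans (ltnW (ltn_expl N (isT : 1 < 3)%N)) _.
  by rewrite leq_pmull// expn_gt0.
rewrite /vec_pair lognM ?expn_gt0// !lognX logn_prime//= (@logn_coprime 2 3)//.
by rewrite muln0 addn0 muln1 pickleK.
Qed.

(** The functional w_n from the definition of X. *)
Definition vcoef n B : C := vfun (vec_pair n).1 (vec_pair n).2 B.

Lemma vcoefD n A B : vcoef n (A + B) = vcoef n A + vcoef n B.
Proof. exact: vfunD. Qed.

Lemma vcoefZ n (a : R[i]) B : vcoef n (a *: B) = a * vcoef n B.
Proof. exact: vfunZ. Qed.

Lemma vcoefN n B : vcoef n (- B) = - vcoef n B.
Proof. exact: vfunN. Qed.

Lemma vcoef0 n : vcoef n 0 = 0.
Proof. exact: vfun0. Qed.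

Lemma vcoef_le n B (M : R) : 0 <= M -> mxle B M -> rnorm (vcoef n B) <= M.
Proof. exact: rnorm_vfun_le. Qed.

Definition asymptotic (x : nat -> C) B :=
  (fun n => x n - vcoef n B) @ \oo --> (0 : C).

Lemma asymptoticP x B : asymptotic x B <->
  forall e : R, 0 < e -> \forall n \near \oo, rnorm (x n - vcoef n B) <= e.
Proof.
rewrite /asymptotic cvg_rnormP; split=> H e /H; apply: filterS => n.
  by rewrite sub0r rnormN.
by rewrite sub0r rnormN.
Qed.

Lemma asymptotic_lin (a : R[i]) (x y : nat -> C) A B :
  asymptotic x A -> asymptotic y B ->
  asymptotic (fun n => a * x n + y n) (a *: A + B).
Proof.
move=> xA yB.
have axA : (fun n => a *: (x n - vcoef n A)) @ \oo --> (a *: 0 : C).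
  by apply: cvgZl_tmp; exact: xA.
have E : (fun n => a * x n + y n - vcoef n (a *: A + B)) =
    (fun n => a *: (x n - vcoef n A)) \+ (fun n => y n - vcoef n B).
  apply/funext => n /=; rewrite vcoefD vcoefZ.
  rewrite -[RHS]/(a * (x n - vcoef n A) + (y n - vcoef n B)); ring.
have := cvgD axA yB; rewrite scaler0 addr0 => h.
by rewrite /asymptotic E; exact: h.
Qed.

Lemma asymptotic_near (x : nat -> C) B (N : nat) :
  (forall n, (N <= n)%N -> x n = vcoef n B) -> asymptotic x B.
Proof.
move=> xB; apply/asymptoticP => e e0; exists N => // n Nn.
by rewrite xB// subrr rnorm0 ltW.
Qed.

(** Every Gaussian pair recurs at arbitrarily late indices, where its value at [B] is as close as
    desired to some [x n]. This makes the quotient map from X to the matrices contractive. *)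
Lemma asymptotic_mxle x B (M : R) : 0 <= M ->
  asymptotic x B -> (forall n, rnorm (x n) <= M) -> mxle B M.
Proof.
move=> M0 /asymptoticP xB xM; apply: mxle_gaussian => // p q.
apply/ler_addgt0Pr => e e0; have [N _ HN] := xB e e0.
have [n Nn En] := vec_pair_recurrent p q N.
have -> : vfun (gaussian_vec p) (gaussian_vec q) B = vcoef n B by rewrite /vcoef En.
have -> : vcoef n B = x n - (x n - vcoef n B) by rewrite subKr.
apply: le_trans (ler_rnormD _ _) _; rewrite rnormN lerD//.
exact: HN.
Qed.

Lemma mxle_entry B (M : R) i j : mxle B M -> rnorm (B i j : C) <= M.
Proof.
move=> /(_ (delta_mx 0 i) (delta_mx 0 j)).
by rewrite dot_delta !vnorm_delta !mulr1.
Qed.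

Lemma mxle0 B : mxle B 0 -> B = 0.
Proof.
move=> B0; apply/matrixP => i j; rewrite mxE; apply: (@rnorm_eq0 R C).
by apply/le_anti; rewrite rnorm_ge0 (mxle_entry _ _ B0).
Qed.

(** The difference is an asymptote of the zero sequence, hence bounded by 0. *)
Lemma asymptotic_uniq x A B : asymptotic x A -> asymptotic x B -> A = B.
Proof.
move=> xA xB; apply/eqP; rewrite -subr_eq0; apply/eqP/mxle0.
apply: (@asymptotic_mxle (fun n => 0)) => //; last by move=> n; rewrite rnorm0.
have := asymptotic_lin (-1) xB xA; rewrite scaleN1r [- _ + _]addrC.
congr asymptotic; apply/funext => n; ring.
Qed.

End vector_functionals.

(** * The sequence space X *)

Section space_X.
Context {R : realType}.
Local Notation C := R[i]^o.
Implicit Types (A B : 'M[R[i]]_2).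

Definition has_asymptote : {pred nat -> C} :=
  fun x => `[< exists B, asymptotic x B >].

Lemma has_asymptoteP (x : nat -> C) :
  reflect (exists B, asymptotic x B) (x \in has_asymptote).
Proof. exact: asboolP. Qed.

Lemma has_asymptote_submod : submod_closed has_asymptote.
Proof.
split=> [|a x y /has_asymptoteP[A xA] /has_asymptoteP[B yB]]; apply/has_asymptoteP.
  by exists 0; apply: (@asymptotic_near _ _ _ 0%N) => n _; rewrite vcoef0.
by exists (a *: A + B); exact: asymptotic_lin.
Qed.

(** The tail is within 1 of the values of bounded functionals at [B], and the head is finite. *)
Lemma has_asymptote_bounded x : x \in has_asymptote ->
  exists M : R, forall n, rnorm (x n) <= M.
Proof.
move=> /has_asymptoteP[B /asymptoticP/(_ 1 ltr01)[N _ HN]].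
have [K K0 BK] := mxle_exists B.
exists (1 + K + \sum_(n < N) rnorm (x n)) => n.
have S0 : 0 <= \sum_(n < N) rnorm (x n) by apply: sumr_ge0 => *; exact: rnorm_ge0.
have [Nn|nN] := leqP N n.
  have -> : x n = x n - vcoef n B + vcoef n B by rewrite subrK.
  apply: le_trans (ler_rnormD _ _) _; rewrite -[leLHS]addr0 !lerD//.
  - exact: HN.
  - exact: vcoef_le.
rewrite -[leLHS]add0r lerD ?addr_ge0//.
by rewrite (bigD1 (Ordinal nN))//= lerDl sumr_ge0// => *; exact: rnorm_ge0.
Qed.

(* The asymptotes of a uniformly convergent sequence are Cauchy. *)
Lemma has_asymptote_closed (f : nat -> C) :
  (forall e : R, 0 < e ->
    exists2 g, g \in has_asymptote & forall n, rnorm (f n - g n) <= e) ->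
  f \in has_asymptote.
Proof.
move=> H.
pose e_ (k : nat) : R := k.+1%:R^-1.
have e_0 k : 0 < e_ k by rewrite invr_gt0.
have small (e : R) : 0 < e -> exists k, forall l, (k <= l)%N -> e_ l <= e.
  move=> e0; exists (Num.truncn e^-1) => l kl.
  rewrite /e_ -[e]invrK lef_pV2 ?posrE ?invr_gt0//; apply: ltW.
  apply: lt_le_trans (truncnS_gt _) _; by rewrite ler_nat ltnS.
have /choice[g gP] : forall k, exists gB : (nat -> C) * 'M[R[i]]_2,
    asymptotic gB.1 gB.2 /\ forall n, rnorm (f n - gB.1 n) <= e_ k.
  move=> k; have [g /has_asymptoteP[B gB] gf] := H _ (e_0 k).
  by exists (g, B).
(* The asymptote of a difference is bounded by its sup norm, so closeness of the sequences passes to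
   the matrix entries. *)
have gBB k l i j : rnorm ((g k).2 i j - (g l).2 i j : C) <= e_ k + e_ l.
  suff h : mxle ((g k).2 - (g l).2) (e_ k + e_ l).
    by have := @mxle_entry _ _ _ i j h; rewrite !mxE.
  apply: (@asymptotic_mxle _ (fun n => (-1) * (g l).1 n + (g k).1 n)).
  - by rewrite addr_ge0 ?ltW.
  - have -> : (g k).2 - (g l).2 = (-1) *: (g l).2 + (g k).2.
      by rewrite scaleN1r addrC.
    apply: asymptotic_lin; [exact: (gP l).1|exact: (gP k).1].
  - move=> n.
    have -> : (-1) * (g l).1 n + (g k).1 n = (f n - (g l).1 n) - (f n - (g k).1 n).
      by rewrite mulN1r; ring.
    apply: le_trans (ler_rnormD _ _) _; rewrite rnormN [leRHS]addrC lerD//.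
      exact: (gP l).2.
    exact: (gP k).2.
have cB i j : cvg ((fun k => (g k).2 i j : C) @ \oo).
  apply: C_complete; apply: cauchy_exP => e e0.
  have er : e = (complex.Re e)%:C by rewrite RRe_real// gtr0_real.
  rewrite er ltcR in e0; have e30 : 0 < complex.Re e / 3 by rewrite divr_gt0.
  have [k Hk] := small _ e30.
  exists ((g k).2 i j : C); exists k => // l kl.
  rewrite -ball_normE /= -rnormE er ltcR; apply: le_lt_trans (gBB _ _ _ _) _.
  have := Hk _ (leqnn k); have := Hk _ kl; lra.
pose B : 'M[R[i]]_2 := \matrix_(i, j) lim ((fun k => (g k).2 i j : C) @ \oo).
apply/has_asymptoteP; exists B; apply/asymptoticP => e e0.
have e30 : 0 < e / 3 by rewrite divr_gt0.
(* An error of e/12 per entry costs 4 (e/12) = e/3 in operator norm, one of three equal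
   contributions. *)
have e120 : 0 < e / 12 by rewrite divr_gt0.
have lB i j : \forall k \near \oo, rnorm (B i j - (g k).2 i j : C) <= e / 12.
  rewrite /B mxE; have /cvg_rnormP := cB i j.
  exact.
have [k0 Hk0] := small _ e30.
near \oo => k.
have Be i j : rnorm ((B - (g k).2) i j : C) <= e / 12.
  rewrite !mxE; have [-> | ->] := I2P i; have [-> | ->] := I2P j.
  - by near: k; have := lB 0 0; rewrite mxE.
  - by near: k; have := lB 0 1; rewrite mxE.
  - by near: k; have := lB 1 0; rewrite mxE.
  - by near: k; have := lB 1 1; rewrite mxE.
have := mxle_entries (ltW e120) Be.
have -> : e / 12 * 2%:R ^+ 2 = e / 3 by field.
move=> Be3.
have /asymptoticP/(_ _ e30) := (gP k).1; apply: filterS => n gn.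
have -> : f n - vcoef n B = (f n - (g k).1 n) + ((g k).1 n - vcoef n (g k).2) -
    vcoef n (B - (g k).2) by rewrite vcoefD vcoefN; ring.
apply: le_trans (ler_rnormD _ _) _; rewrite rnormN.
have h1 : rnorm (f n - (g k).1 n) <= e / 3.
  apply: le_trans ((gP k).2 n) _; apply: Hk0.
  by near: k; exists k0.
have h3 : rnorm (vcoef n (B - (g k).2)) <= e / 3 by apply: vcoef_le => //; exact: ltW.
have h2 := ler_rnormD (f n - (g k).1 n) ((g k).1 n - vcoef n (g k).2).
move: h1 h2 h3 gn; move: (rnorm _) (rnorm _) (rnorm _) (rnorm _) => a b c d; lra.
Unshelve. all: by end_near. Qed.

Definition Xsub : @usub R nat :=
  USub has_asymptote_submod 0%N has_asymptote_bounded has_asymptote_closed.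

End space_X.

(** * The C*-algebra *)

Section algebra_A.
Context {R : realType}.
Local Notation C := R[i]^o.
Local Notation V2 := 'rV[R[i]]_2.
Implicit Types (B : 'M[R[i]]_2) (u v : V2).

(* An element of [l^oo (+) M_2(C)], encoded by the entries of the sequence and
   the values of the functionals [vfun u v] on the matrix. *)
Definition block_fun (b : nat -> C) B (i : nat + V2 * V2) : C :=
  match i with inl n => b n | inr (u, v) => vfun u v B end.

Definition is_block : {pred nat + V2 * V2 -> C} :=
  fun F => `[< (exists M : R, forall n, rnorm (F (inl n)) <= M) /\
    exists B, F = block_fun (F \o inl) B >].

Lemma is_blockP F : reflect ((exists M : R, forall n, rnorm (F (inl n)) <= M) /\
    exists B, F = block_fun (F \o inl) B) (F \in is_block).
Proof. exact: asboolP. Qed.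

Lemma block_fun_in b B : (exists M : R, forall n, rnorm (b n) <= M) ->
  block_fun b B \in is_block.
Proof. by move=> bM; apply/is_blockP; split=> //; exists B. Qed.

Lemma is_block_submod : submod_closed is_block.
Proof.
split=> [|a F G /is_blockP[[M FM] [A FA]] /is_blockP[[N GN] [B GB]]]; apply/is_blockP.
  split; first by exists 0 => n; rewrite rnorm0.
  by exists 0; apply/funext => -[n|[u v]] //=; rewrite vfun0.
split.
  exists (rnorm (a : C) * M + N) => n; apply: le_trans (ler_rnormD _ _) _.
  by rewrite rnormM lerD// ler_wpM2l ?rnorm_ge0.
exists (a *: A + B); apply/funext => -[n|[u v]] //=.
by rewrite vfunD vfunZ {1}FA {1}GB.
Qed.

Lemma is_block_bounded F : F \in is_block -> exists M : R, forall i, rnorm (F i) <= M.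
Proof.
move=> /is_blockP[[M FM] [B FB]]; have [K K0 BK] := mxle_exists B.
have M0 : 0 <= M by exact: le_trans (rnorm_ge0 _) (FM 0%N).
exists (M + K) => -[n|[u v]].
  by rewrite -[leLHS]addr0 lerD.
rewrite FB /= -[leLHS]add0r lerD//; exact: rnorm_vfun_le.
Qed.

Lemma vfun_delta i j B : vfun (delta_mx 0 i) (delta_mx 0 j) B = B i j.
Proof. by rewrite /vfun dot_delta !vnorm_delta mulr1 divr1. Qed.

Lemma is_block_closed (F : nat + V2 * V2 -> C) :
  (forall e : R, 0 < e ->
    exists2 G, G \in is_block & forall i, rnorm (F i - G i) <= e) ->
  F \in is_block.
Proof.
move=> H; apply/is_blockP; split.
  have [G /is_block_bounded[M GM] FG] := H 1 ltr01.
  exists (1 + M) => n; have -> : F (inl n) = (F (inl n) - G (inl n)) + G (inl n).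
    by rewrite subrK.
  by apply: le_trans (ler_rnormD _ _) _; rewrite lerD.
pose B : 'M[R[i]]_2 := \matrix_(i, j) F (inr (delta_mx 0 i, delta_mx 0 j)).
exists B; apply/funext => -[n|[u v]] //=.
apply/eqP; rewrite -subr_eq0; apply/eqP/rnorm_eq0/le_anti; rewrite rnorm_ge0 andbT.
apply/ler_addgt0Pr => e e0; rewrite add0r.
(* One fifth for the value at (u, v), four for the matrix, whose entries are each off by at most
   e/5. *)
have e50 : 0 < e / 5 by rewrite divr_gt0.
have [G /is_blockP[_ [A GA]] FG] := H _ e50.
have GE x y : G (inr (x, y)) = vfun x y A by rewrite GA.
have -> : F (inr (u, v)) - vfun u v B = (F (inr (u, v)) - G (inr (u, v))) - vfun u v (B - A).
  by rewrite vfunD vfunN GE; ring.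
apply: le_trans (ler_rnormD _ _) _; rewrite rnormN.
have BA : mxle (B - A) (e / 5 * 2%:R ^+ 2).
  apply: mxle_entries => [|i j]; first exact: ltW.
  rewrite !mxE -vfun_delta.
  have := FG (inr (delta_mx 0 i, delta_mx 0 j)).
  by rewrite GE.
have h : rnorm (vfun u v (B - A)) <= e / 5 * 2%:R ^+ 2.
  apply: rnorm_vfun_le; last exact: BA.
  by apply: mulr_ge0; [exact: ltW|exact: sqr_ge0].
have := FG (inr (u, v)); move: h; move: (rnorm _) (rnorm _) => x y; lra.
Qed.

Definition Asub : @usub R (nat + V2 * V2) :=
  USub is_block_submod (inl 0%N) is_block_bounded is_block_closed.

Local Notation A := (uspace Asub).
Implicit Types (a c : A).

Definition seq_part a (n : nat) : C := a (inl n).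
Definition mx_part a : 'M[R[i]]_2 :=
  \matrix_(i, j) a (inr (delta_mx 0 i, delta_mx 0 j)).

Lemma seq_part_bounded a : exists M : R, forall n, rnorm (seq_part a n) <= M.
Proof. by exists (rnorm a) => n; exact: ler_ufun. Qed.

Definition block b B (bM : exists M : R, forall n, rnorm (b n) <= M) : A :=
  USpace (P := Asub) (block_fun_in B bM).

Lemma seq_part_block b B bM n : seq_part (block (b := b) B bM) n = b n.
Proof. by []. Qed.

Lemma mx_part_block b B bM : mx_part (block (b := b) B bM) = B.
Proof. by apply/matrixP => i j; rewrite !mxE /= vfun_delta. Qed.

Lemma blockE a : a = block (mx_part a) (seq_part_bounded a).
Proof.
apply: ufun_inj => -[n|[u v]] //=.
have /is_blockP[_ [B aB]] := valP a.
have -> : mx_part a = B.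
  apply/matrixP => i j.
  by rewrite mxE [LHS](congr1 (fun f => f _) aB) /= vfun_delta.
exact: (congr1 (fun f => f _) aB).
Qed.

Lemma block_ext a c : seq_part a =1 seq_part c -> mx_part a = mx_part c -> a = c.
Proof.
move=> ac mac; apply: ufun_inj => -[n|[u v]]; first exact: ac.
by rewrite [a]blockE [c]blockE /= mac.
Qed.

Lemma seq_partD a c n : seq_part (a + c) n = seq_part a n + seq_part c n.
Proof. by []. Qed.

Lemma seq_partZ (k : R[i]) a n : seq_part (k *: a) n = k * seq_part a n.
Proof. by []. Qed.

Lemma mx_partD a c : mx_part (a + c) = mx_part a + mx_part c.
Proof. by apply/matrixP => i j; rewrite !mxE. Qed.

Lemma mx_partZ (k : R[i]) a : mx_part (k *: a) = k *: mx_part a.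
Proof. by apply/matrixP => i j; rewrite !mxE. Qed.

Lemma seq_part_le a n : rnorm (seq_part a n) <= rnorm a.
Proof. exact: ler_ufun. Qed.

(** The index set contains all pairs of vectors, so the sup norm dominates the operator norm. With
    [seq_part_le] and [rnorm_block_le], the norm is the maximum of the sup norm of the sequence and
    the operator norm of the matrix. *)
Lemma mx_part_le a : mxle (mx_part a) (rnorm a).
Proof.
move=> u v; rewrite rnorm_dot_vfun ler_wpM2r ?mulr_ge0 ?vnorm_ge0//.
have -> : vfun u v (mx_part a) = a (inr (u, v)) by rewrite [in RHS](blockE a).
exact: ler_ufun.
Qed.

Lemma rnorm_block_le a (M : R) : 0 <= M ->
  (forall n, rnorm (seq_part a n) <= M) -> mxle (mx_part a) M -> rnorm a <= M.
Proof.
move=> M0 aM maM; apply: rnorm_ufun_le => -[n|[u v]]; first exact: aM.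
by rewrite [a]blockE /=; exact: rnorm_vfun_le.
Qed.

Lemma cmul_bounded a c :
  exists M : R, forall n, rnorm (seq_part a n * seq_part c n) <= M.
Proof.
by exists (rnorm a * rnorm c) => n; rewrite rnormM ler_pM ?rnorm_ge0 ?seq_part_le.
Qed.

Lemma cstar_bounded a : exists M : R, forall n, rnorm ((seq_part a n)^*%C : C) <= M.
Proof. by exists (rnorm a) => n; rewrite rnorm_conj seq_part_le. Qed.

Definition block_mul a c : A := block (mx_part a *m mx_part c) (cmul_bounded a c).
Definition block_star a : A := block ((mx_part a)^t* ) (cstar_bounded a).

Let blockM := (mx_part_block, mx_partD, mx_partZ).

Lemma block_mulA : associative block_mul.
Proof.
move=> a b c; apply: block_ext => [n|]; first exact: mulrA.
by rewrite !blockM mulmxA.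
Qed.

Lemma block_mulDl : left_distributive block_mul +%R.
Proof.
move=> a b c; apply: block_ext => [n|]; first exact: mulrDl.
by rewrite !blockM mulmxDl.
Qed.

Lemma block_mulDr : right_distributive block_mul +%R.
Proof.
move=> a b c; apply: block_ext => [n|]; first exact: mulrDr.
by rewrite !blockM mulmxDr.
Qed.

Lemma block_mulZl (k : R[i]) a c : block_mul (k *: a) c = k *: block_mul a c.
Proof.
apply: block_ext => [n|]; first by rewrite seq_partZ /= mulrA.
by rewrite !blockM scalemxAl.
Qed.

Lemma block_mulZr (k : R[i]) a c : block_mul a (k *: c) = k *: block_mul a c.
Proof.
apply: block_ext => [n|]; first by rewrite seq_partZ /= mulrCA.
by rewrite !blockM scalemxAr.
Qed.

Lemma block_normM a c : `|block_mul a c| <= `|a| * `|c|.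
Proof.
rewrite -!rnormE -rmorphM /= lecR; apply: rnorm_block_le => [|n|].
- by rewrite mulr_ge0 ?rnorm_ge0.
- by rewrite seq_part_block rnormM ler_pM ?rnorm_ge0 ?seq_part_le.
by rewrite blockM; apply: mxleM; rewrite ?rnorm_ge0//; exact: mx_part_le.
Qed.

Lemma block_starK : involutive block_star.
Proof.
move=> a; apply: block_ext => [n|]; first exact: conjcK.
by rewrite !blockM trmxCK.
Qed.

Lemma block_starD : {morph block_star : x y / x + y}.
Proof.
move=> a c; apply: block_ext => [n|]; first exact: rmorphD.
by rewrite !blockM linearD /= map_mxD.
Qed.

Lemma block_starZ (k : R[i]) a : block_star (k *: a) = k^*%C *: block_star a.
Proof.
apply: block_ext => [n|]; first exact: rmorphM.
by rewrite !blockM linearZ /= map_mxZ.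
Qed.

Lemma block_starM a c : block_star (block_mul a c) = block_mul (block_star c) (block_star a).
Proof.
apply: block_ext => [n|]; first by rewrite !seq_part_block rmorphM mulrC.
by rewrite !blockM trmx_mul map_mxM.
Qed.

(** One inequality is submultiplicativity in each summand; the other reads the bound off every
    coordinate and, for the matrix, uses [mxle_adjM]. *)
Lemma block_norm_star a : `|block_mul (block_star a) a| = `|a| ^+ 2.
Proof.
rewrite -!rnormE -rmorphXn /=; congr (_%:C); apply/le_anti/andP; split.
  apply: rnorm_block_le => [|n|]; first exact: sqr_ge0.
    by rewrite !seq_part_block rnormM rnorm_conj expr2 ler_pM ?rnorm_ge0 ?seq_part_le.
  rewrite !blockM expr2; apply: mxleM; rewrite ?rnorm_ge0//; last exact: mx_part_le.
  by apply: mxle_adj; exact: mx_part_le.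
set r := rnorm (block_mul _ _).
have r0 : 0 <= r by exact: rnorm_ge0.
suff : rnorm a <= Num.sqrt r.
  by move=> h; rewrite -(sqr_sqrtr r0) ler_sqr ?nnegrE ?rnorm_ge0 ?sqrtr_ge0.
apply: rnorm_block_le => [|n|]; first exact: sqrtr_ge0.
  rewrite -ler_sqr ?nnegrE ?rnorm_ge0 ?sqrtr_ge0// sqr_sqrtr//.
  have := seq_part_le (block_mul (block_star a) a) n.
  by rewrite !seq_part_block rnormM rnorm_conj -expr2.
apply: mxle_adjM; first exact: sqrtr_ge0.
rewrite sqr_sqrtr//.
by have := mx_part_le (block_mul (block_star a) a); rewrite !blockM.
Qed.

HB.instance Definition _ := isCstarAlgebra.Build R A
  block_mulA block_mulDl block_mulDr block_mulZl block_mulZr block_normM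
  block_starK block_starD block_starZ block_starM block_norm_star.

End algebra_A.

(** * The bidual of X *)

Section bop_of_bound.
Context {R : realType} {V W : normedModType R[i]}.

Definition bounded_op (f : V -> W) (M : R) (lf : linear f)
  (fM : forall x, rnorm (f x) <= M * rnorm x) : bop V W :=
  Bop (is_bop_bounded lf fM).

Lemma rnorm_bounded_op f M lf fM : 0 <= M -> rnorm (@bounded_op f M lf fM) <= M.
Proof. by move=> M0; exact: opnorm_le. Qed.

Lemma ler_bop (f : bop V W) x : rnorm (f x) <= rnorm f * rnorm x.
Proof. exact: le_opnorm. Qed.

Lemma bopD (f : bop V W) x y : f (x + y) = f x + f y.
Proof. exact: linearD. Qed.

Lemma bopZ (f : bop V W) (a : R[i]) x : f (a *: x) = a *: f x.
Proof. exact: linearZ. Qed.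

Lemma bop0 (f : bop V W) : f 0 = 0.
Proof. exact: linear0. Qed.

Lemma bopB (f : bop V W) x y : f (x - y) = f x - f y.
Proof. exact: linearB. Qed.

Lemma bopP (f : bop V W) (a : R[i]) x y : f (a *: x + y) = a *: f x + f y.
Proof. exact: linearP. Qed.

Lemma bop_ext (f g : bop V W) : f =1 g -> f = g.
Proof. by move=> fg; apply/val_inj/funext. Qed.

Lemma cvg_rnorm_le (s : nat -> V) (l : V) (M : R) :
  s @ \oo --> l -> (forall n, rnorm (s n) <= M) -> rnorm l <= M.
Proof.
move=> /cvg_rnormP sl sM; apply/ler_addgt0Pr => e e0.
have [N _ HN] := sl e e0.
have -> : l = (l - s N) + s N by rewrite subrK.
apply: le_trans (ler_rnormD _ _) _; rewrite addrC lerD//.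
by apply: HN => /=.
Qed.

End bop_of_bound.

(** * The pairing between the C*-algebra and the dual of X *)

Section duality.
Context {R : realType}.
Local Notation C := R[i]^o.
Local Notation X := (uspace (@Xsub R)).
Local Notation A := (uspace (@Asub R)).
Implicit Types (x y : X) (a c : A) (f : dual X) (B : 'M[R[i]]_2).

Lemma asymptote_exists x : exists B, asymptotic x B.
Proof. exact/has_asymptoteP/(valP x). Qed.

Definition asymptote x : 'M[R[i]]_2 := projT1 (cid (asymptote_exists x)).

Lemma asymptoteP x : asymptotic x (asymptote x).
Proof. exact: projT2 (cid (asymptote_exists x)). Qed.

Lemma asymptoteE x B : asymptotic x B -> asymptote x = B.
Proof. exact: asymptotic_uniq (asymptoteP x). Qed.

Lemma asymptote_lin (k : R[i]) x y :
  asymptote (k *: x + y) = k *: asymptote x + asymptote y.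
Proof. by apply/asymptoteE/asymptotic_lin; exact: asymptoteP. Qed.

Lemma asymptote_le x : mxle (asymptote x) (rnorm x).
Proof.
apply: asymptotic_mxle (asymptoteP x) _; first exact: rnorm_ge0.
by move=> n; exact: ler_ufun.
Qed.

Definition of_asymptotic (x : nat -> C) B (xB : asymptotic x B) : X :=
  USpace (P := Xsub) (introT (has_asymptoteP x) (ex_intro _ B xB)).

Lemma asymptote_of x B xB : asymptote (@of_asymptotic x B xB) = B.
Proof. exact: asymptoteE. Qed.

Lemma unit_seq_asymptotic n : asymptotic (fun m => (m == n)%:R) (0 : 'M[R[i]]_2).
Proof.
apply: (@asymptotic_near _ _ _ n.+1) => m nm.
by rewrite vcoef0 gtn_eqF.
Qed.

Definition unit_seq n : X := of_asymptotic (unit_seq_asymptotic n).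

Lemma splice_asymptotic N a : asymptotic
  (fun n => if (n < N)%N then seq_part a n else vcoef n (mx_part a)) (mx_part a).
Proof.
by apply: (@asymptotic_near _ _ _ N) => n Nn; rewrite ltnNge Nn.
Qed.

(** Approximants of [a] inside X, all bounded by the norm of [a]: they agree with its sequence below
    [N] and have its matrix as asymptote. Functionals on X are extended to [a] along them. *)
Definition splice N a : X := of_asymptotic (splice_asymptotic N a).

Lemma spliceE N a n :
  splice N a n = if (n < N)%N then seq_part a n else vcoef n (mx_part a).
Proof. by []. Qed.

Lemma asymptote_splice N a : asymptote (splice N a) = mx_part a.
Proof. exact: asymptote_of. Qed.

Lemma splice_le N a : rnorm (splice N a) <= rnorm a.
Proof.
apply: rnorm_ufun_le => n; rewrite spliceE; case: ifP => _.
  exact: seq_part_le.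
by apply: vcoef_le; [exact: rnorm_ge0|exact: mx_part_le].
Qed.

Lemma splice_lin N (k : R[i]) a c :
  splice N (k *: a + c) = k *: splice N a + splice N c.
Proof.
apply: ufun_inj => n; rewrite ufunD ufunZ !spliceE mx_partD mx_partZ vcoefD vcoefZ.
by case: ifP.
Qed.

Lemma spliceS N a : splice N.+1 a =
  splice N a + ((seq_part a N - vcoef N (mx_part a)) : R[i]) *: unit_seq N.
Proof.
apply: ufun_inj => n; rewrite ufunD ufunZ !spliceE ltnS leq_eqVlt.
rewrite -[unit_seq N n]/((n == N)%:R : C).
have [->|nN] := eqVneq n N; first by rewrite ltnn /= mulr1 addrC subrK.
by rewrite mulr0 addr0.
Qed.

Lemma splice_sum f N a : f (splice N a) = f (splice 0 a) +
  \sum_(0 <= n < N) (seq_part a n - vcoef n (mx_part a)) * f (unit_seq n).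
Proof.
elim: N => [|N IH]; first by rewrite big_geq// addr0.
by rewrite spliceS bopD bopZ IH big_nat_recr//= addrA.
Qed.

Lemma zero_bounded : exists M : R, forall n : nat, rnorm (0 : C) <= M.
Proof. by exists 0 => _; rewrite rnorm0. Qed.

Lemma splice_sum0 f N b bM :
  f (splice N (block (b := b) 0 bM)) = \sum_(0 <= n < N) b n * f (unit_seq n).
Proof.
rewrite splice_sum.
have -> : splice 0 (block 0 bM) = 0.
  by apply: ufun_inj => n; rewrite spliceE mx_part_block vcoef0.
rewrite bop0 add0r; apply: eq_bigr => n _.
by rewrite mx_part_block vcoef0 subr0.
Qed.

(** Evaluate [f] at the finitely supported sequence of phases, which has norm at most 1. Thus the
    values at the unit sequences form an element of l^1. *)
Lemma sum_unit_seq_le f N : \sum_(0 <= n < N) rnorm (f (unit_seq n)) <= rnorm f.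
Proof.
have bM : exists M : R, forall n, rnorm (phase (f (unit_seq n))) <= M.
  by exists 1 => n; rewrite rnorm_phase.
have a1 : rnorm (block (b := fun n => phase (f (unit_seq n))) 0 bM) <= 1.
  apply: rnorm_block_le => // [n|]; first by rewrite seq_part_block rnorm_phase.
  by rewrite mx_part_block => u v; rewrite mulmx0 dot0l rnorm0 mul1r mulr_ge0 ?vnorm_ge0.
have := ler_bop f (splice N (block 0 bM)).
rewrite splice_sum0.
under eq_bigr do rewrite phaseM.
rewrite -rmorph_sum /= rnorm_real ger0_norm; last first.
  by apply: sumr_ge0 => *; exact: rnorm_ge0.
move=> /le_trans; apply; rewrite ler_piMr ?rnorm_ge0//.
exact: le_trans (splice_le _ _) a1.
Qed.

Lemma cvg_unit_seq f : cvgn (series (fun n => rnorm (f (unit_seq n)))).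
Proof.
apply: nondecreasing_is_cvgn.
  by apply: nondecreasing_series => n _ _; exact: rnorm_ge0.
by exists (rnorm f) => _ [N _ <-]; exact: sum_unit_seq_le.
Qed.

Definition biduality_fun a f : C := lim ((fun N => f (splice N a)) @ \oo).

(** Consecutive splices differ by a multiple of [unit_seq n] with coefficient at most 2 |a|, so the
    sequence is a constant plus an absolutely convergent series. *)
Lemma biduality_cvg a f : (fun N => f (splice N a)) @ \oo --> biduality_fun a f.
Proof.
pose s := series (fun n => (seq_part a n - vcoef n (mx_part a)) * f (unit_seq n)).
have cs : cvgn s.
  apply: (@cvg_series_rnorm _ _ (fun n => (rnorm a + rnorm a) * rnorm (f (unit_seq n)))).
    move=> n; rewrite rnormM ler_wpM2r ?rnorm_ge0//.
    apply: le_trans (ler_rnormD _ _) _; rewrite rnormN lerD ?seq_part_le//.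
    by apply: vcoef_le; [exact: rnorm_ge0|exact: mx_part_le].
  have a0 : 0 <= rnorm a + rnorm a by rewrite addr_ge0 ?rnorm_ge0.
  apply: nondecreasing_is_cvgn.
    by apply: nondecreasing_series => n _ _; rewrite mulr_ge0 ?rnorm_ge0.
  exists ((rnorm a + rnorm a) * rnorm f) => _ [N _ <-].
  by rewrite /series /= -mulr_sumr ler_wpM2l// sum_unit_seq_le.
suff : cvg ((fun N => f (splice N a) : C) @ \oo) by [].
have -> : (fun N => f (splice N a)) = (fun=> f (splice 0 a)) \+ s.
  by apply/funext => N; rewrite splice_sum.
have h := cvgD (cvg_cst (f (splice 0 a) : C)) cs.
by apply/cvg_ex; eexists; exact: h.
Qed.

Lemma biduality_eq a f (l : C) :
  (fun N => f (splice N a)) @ \oo --> l -> biduality_fun a f = l.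
Proof. by move=> h; apply: cvg_lim h; exact: (@norm_hausdorff _ C). Qed.

Lemma biduality_cvgZ (k : R[i]) a f :
  (fun N => k *: (f (splice N a) : C)) @ \oo --> (k *: biduality_fun a f : C).
Proof. by apply: cvgZl_tmp; exact: biduality_cvg. Qed.

Lemma biduality_fun_linear a : linear (biduality_fun a : dual X -> C).
Proof.
move=> k f g; apply: biduality_eq.
have h := cvgD (@biduality_cvgZ k a f) (@biduality_cvg a g).
exact: h.
Qed.

Lemma biduality_linl (k : R[i]) a c f :
  biduality_fun (k *: a + c) f = k * biduality_fun a f + biduality_fun c f.
Proof.
apply: biduality_eq.
have h := cvgD (@biduality_cvgZ k a f) (@biduality_cvg c f).
have E : (fun N => f (splice N (k *: a + c))) =
  (fun N => k *: f (splice N a)) \+ (fun N => f (splice N c)).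
  by apply/funext => N; rewrite splice_lin bopP.
by rewrite E; exact: h.
Qed.

Lemma biduality_fun_le a f : rnorm (biduality_fun a f) <= rnorm a * rnorm f.
Proof.
apply: cvg_rnorm_le (@biduality_cvg a f) _ => N.
apply: le_trans (ler_bop _ _) _; rewrite mulrC ler_wpM2r ?rnorm_ge0//.
exact: splice_le.
Qed.

Definition biduality a : dual (dual X) :=
  bounded_op (@biduality_fun_linear a) (biduality_fun_le a).

Lemma biduality_le a : rnorm (biduality a) <= rnorm a.
Proof. exact: rnorm_bounded_op (rnorm_ge0 a). Qed.

Lemma coordinate_linear n : linear (fun x : X => x n : C).
Proof. by []. Qed.

Lemma coordinate_le n x : rnorm (x n) <= 1 * rnorm x.
Proof. by rewrite mul1r; exact: ler_ufun. Qed.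

Definition coordinate n : dual X := bounded_op (@coordinate_linear n) (coordinate_le n).

Lemma rnorm_coordinate_le n : rnorm (coordinate n) <= 1.
Proof. exact: rnorm_bounded_op. Qed.

Lemma asym_fun_linear (u v : 'rV[R[i]]_2) :
  linear (fun x : X => dot (u *m asymptote x) v).
Proof.
by move=> k x y; rewrite asymptote_lin mulmxDr -scalemxAr dotDl dotZl.
Qed.

Lemma asym_fun_le (u v : 'rV[R[i]]_2) x :
  rnorm (dot (u *m asymptote x) v) <= vnorm u * vnorm v * rnorm x.
Proof. by rewrite mulrC; exact: asymptote_le. Qed.

Definition asym_fun u v : dual X :=
  bounded_op (@asym_fun_linear u v) (asym_fun_le u v).

Lemma rnorm_asym_fun_le u v : rnorm (asym_fun u v) <= vnorm u * vnorm v.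
Proof. by apply: rnorm_bounded_op; rewrite mulr_ge0 ?vnorm_ge0. Qed.

Lemma biduality_coordinate a n : biduality a (coordinate n) = seq_part a n.
Proof.
apply: biduality_eq; apply: cvg_near_cst.
(* From N = n + 1 on, the splice takes its n-th coordinate from [a]. *)
exists n.+1 => // N /= nN.
by rewrite nN.
Qed.

Lemma biduality_asym_fun a u v : biduality a (asym_fun u v) = dot (u *m mx_part a) v.
Proof.
apply: biduality_eq; apply: cvg_near_cst.
apply: nearW => N.
by rewrite /= asymptote_splice.
Qed.

Lemma ufun_bounded x : exists M : R, forall n, rnorm (x n : C) <= M.
Proof. by exists (rnorm x) => n; exact: ler_ufun. Qed.

Definition embed x : A := block (asymptote x) (ufun_bounded x).

(** The splices of an element of X converge to it in norm, because x_n - w_n(B) tends to 0; so the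
    pairing extends evaluation. *)
Lemma biduality_embed x f : biduality (embed x) f = f x.
Proof.
apply: biduality_eq; apply/cvg_rnormP => e e0.
(* Adding 1 avoids a division by zero when f = 0. *)
pose d := e / (rnorm f + 1).
have f1 : 0 < rnorm f + 1 by rewrite ltr_wpDl ?rnorm_ge0.
have d0 : 0 < d by rewrite divr_gt0.
have /asymptoticP/(_ d d0)[N _ HN] := asymptoteP x.
exists N => // M /= NM; rewrite -bopB.
apply: le_trans (ler_bop _ _) _.
have h : rnorm (x - splice M (embed x)) <= d.
  apply: rnorm_ufun_le => n; rewrite ufunB spliceE; case: ltnP => nM.
    by rewrite subrr rnorm0 ltW.
  by rewrite mx_part_block; apply: HN; exact: leq_trans nM.
apply: (@le_trans _ _ ((rnorm f + 1) * d)).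
  by apply: ler_pM; rewrite ?rnorm_ge0// lerDl.
by rewrite /d mulrC divfK// gt_eqF.
Qed.

(** The decomposition of a functional into its l^1 part and its matrix part. *)
Lemma biduality_block_split b B bM f : biduality (block (b := b) B bM) f =
  biduality (block (b := b) 0 bM) f + biduality (block B zero_bounded) f.
Proof.
have -> : block B bM = 1 *: block 0 bM + block B zero_bounded.
  apply: block_ext => [n|]; first by rewrite seq_partD seq_partZ mul1r addr0.
  by rewrite mx_partD mx_partZ !mx_part_block scaler0 add0r.
by rewrite [LHS]biduality_linl mul1r.
Qed.

Lemma biduality_mx_linear f : linear (fun B => biduality (block B zero_bounded) f : C).
Proof.
move=> k B B'.
have -> : block (k *: B + B') zero_bounded =
    k *: block B zero_bounded + block B' zero_bounded.
  apply: block_ext => [n|].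
    by rewrite seq_partD seq_partZ !seq_part_block mulr0 addr0.
  by rewrite mx_partD mx_partZ !mx_part_block.
exact: biduality_linl.
Qed.

End duality.

Lemma ler_rnorm_sum (R : realType) (V : normedModType R[i]) (I : Type)
    (r : seq I) (P : pred I) (F : I -> V) :
  rnorm (\sum_(k <- r | P k) F k) <= \sum_(k <- r | P k) rnorm (F k).
Proof.
elim/big_rec2: _ => [|k y x _ xy]; first by rewrite rnorm0.
by apply: le_trans (ler_rnormD _ _) _; rewrite lerD2l.
Qed.

Lemma bop_combE (R : realType) (V W : normedModType R[i]) (k : R[i])
  (f g : bop V W) x : (k *: f + g) x = k *: f x + g x.
Proof. by []. Qed.

(** * The isometry of the bidual onto the C*-algebra *)

Section bidual.
Context {R : realType}.
Local Notation C := R[i]^o.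
Local Notation X := (uspace (@Xsub R)).
Local Notation A := (uspace (@Asub R)).
Implicit Types (x y : X) (a c : A) (f : dual X) (B : 'M[R[i]]_2)
  (Psi : dual (dual X)).

Definition mx_block B : A := block B zero_bounded.

Lemma biduality_mx_sum f B : biduality (mx_block B) f =
  \sum_i \sum_j B i j * biduality (mx_block (delta_mx i j)) f.
Proof.
have lb := biduality_mx_linear f.
pose g : {linear 'M[R[i]]_2 -> C} := HB.pack (fun B => biduality (mx_block B) f : C)
  (GRing.isLinear.Build R[i] _ C *:%R _ lb).
rewrite -[LHS]/(g B) [in LHS](matrix_sum_delta B) linear_sum.
apply: eq_bigr => i _; rewrite linear_sum; apply: eq_bigr => j _.
exact: linearZ.
Qed.

Lemma cvg_series_tail (u : nat -> R) (e : R) : cvgn (series u) ->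
  (forall n, 0 <= u n) -> 0 < e ->
  exists N, forall M, (N <= M)%N -> \sum_(N <= n < M) u n <= e.
Proof.
move=> /cauchy_cvgP/cauchy_seriesP cu u0 e0.
have [[P Q] [/= [N _ HN] [M _ HM]] HPQ] := cu e e0.
exists (maxn N M) => K NK.
have := HPQ (maxn N M, K) => /=; rewrite ger0_norm ?sumr_ge0// => h.
apply/ltW/h; split; first by apply: HN; rewrite /= leq_maxl.
by apply: HM => /=; apply: leq_trans NK; rewrite leq_maxr.
Qed.

(* Every functional is a norm limit of combinations of the [coordinate n] and the
   [asym_fun u v]: cut off the coordinates below [N]. *)
Lemma bidual_vanish Psi : (forall n, Psi (coordinate n) = 0) ->
  (forall i j, Psi (asym_fun (delta_mx 0 i) (delta_mx 0 j)) = 0) -> Psi = 0.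
Proof.
move=> Pc Pm; apply: bop_ext => f; rewrite -[RHS]/(0 : C).
apply/rnorm_eq0/le_anti; rewrite rnorm_ge0 andbT; apply/ler_addgt0Pr => e e0.
rewrite add0r.
pose d := e / (rnorm Psi + 1).
have P1 : 0 < rnorm Psi + 1 by rewrite ltr_wpDl ?rnorm_ge0.
have d0 : 0 < d by rewrite divr_gt0.
have [N HN] := cvg_series_tail (@cvg_unit_seq R f) (fun n => rnorm_ge0 _) d0.
(* The first [N] terms of the l^1 part of [f] and its whole matrix part, so that [f - h] is a tail
   of norm at most [d]. *)
pose h : dual X := \sum_(0 <= n < N) (f (unit_seq n) : R[i]) *: coordinate n +
  \sum_i \sum_j (biduality (mx_block (delta_mx i j)) f : R[i]) *:
     asym_fun (delta_mx 0 i) (delta_mx 0 j).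
have bop_sum (I : Type) (r : seq I) (P : pred I) (F : I -> dual X) x :
    (\sum_(k <- r | P k) F k) x = \sum_(k <- r | P k) F k x.
  by elim/big_rec2: _ => // k y1 y2 _ <-.
have hE x : h x = \sum_(0 <= n < N) x n * f (unit_seq n) +
    biduality (mx_block (asymptote x)) f.
  rewrite -[h x]/((\sum_(0 <= n < N) (f (unit_seq n) : R[i]) *: coordinate n) x +
    (\sum_i \sum_j (biduality (mx_block (delta_mx i j)) f : R[i]) *:
     asym_fun (delta_mx 0 i) (delta_mx 0 j)) x).
  rewrite !bop_sum biduality_mx_sum; congr (_ + _).
    by apply: eq_bigr => n _; rewrite mulrC.
  apply: eq_bigr => i _; rewrite bop_sum; apply: eq_bigr => j _.
  by rewrite -[asymptote x i j]dot_delta mulrC.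
have fh : rnorm (f - h) <= d.
  apply: opnorm_le => [|x]; first exact: ltW.
  rewrite -[(f - h) x]/(f x - h x) hE -(biduality_embed x f) /embed.
  rewrite (biduality_block_split (asymptote x)).
  rewrite opprD addrACA subrr addr0.
  rewrite -(splice_sum0 f N (ufun_bounded x)).
  set a := block 0 _.
  have cv : (fun M => f (splice M a) - f (splice N a) : C) @ \oo -->
      (biduality a f - f (splice N a) : C).
    exact: cvgB (@biduality_cvg _ a f) (cvg_cst _).
  apply: (@le_trans _ _ (rnorm (biduality a f - f (splice N a) : C))) => //.
  (* After the shift every term of the sequence is a sum over n from N to M + N, bounded by d
     |x|. *)
  rewrite -(cvg_shiftn N) in cv.
  apply: (cvg_rnorm_le cv) => M /=.
  rewrite !splice_sum0 (big_cat_nat _ (n := N))//= ?leq_addl// addrAC subrr add0r.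
  apply: (@le_trans _ _ (\sum_(N <= n < M + N) rnorm x * rnorm (f (unit_seq n)))).
    apply: le_trans (ler_rnorm_sum _ _ _) _; apply: ler_sum => n _.
    by rewrite rnormM ler_wpM2r ?rnorm_ge0 ?ler_ufun.
  by rewrite -mulr_sumr mulrC ler_wpM2r ?rnorm_ge0// HN// leq_addl.
have Ph : Psi h = 0.
  rewrite bopD [Psi (\sum_(0 <= n < N) _)]linear_sum big1 => [|n _]; last first.
    by rewrite linearZ /= Pc scaler0.
  rewrite add0r linear_sum big1 => // i _; rewrite linear_sum big1 => // j _.
  by rewrite linearZ /= Pm scaler0.
have -> : Psi f = Psi (f - h) by rewrite bopB Ph subr0.
apply: le_trans (ler_bop _ _) _.
apply: (@le_trans _ _ ((rnorm Psi + 1) * d)).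
  by apply: ler_pM; rewrite ?rnorm_ge0// lerDl.
by rewrite /d mulrC divfK// gt_eqF.
Qed.

Lemma coordinate_bounded Psi : exists M : R, forall n, rnorm (Psi (coordinate n)) <= M.
Proof.
exists (rnorm Psi) => n; apply: le_trans (ler_bop _ _) _.
by rewrite ler_piMr ?rnorm_ge0 ?rnorm_coordinate_le.
Qed.

Definition bidual_block Psi : A :=
  block (\matrix_(i, j) Psi (asym_fun (delta_mx 0 i) (delta_mx 0 j)))
    (coordinate_bounded Psi).

(** Both functionals agree on the coordinates and the matrix entries, so [bidual_vanish] applies to
    their difference; this is surjectivity of [biduality]. *)
Lemma bidual_blockK : cancel bidual_block (@biduality R).
Proof.
move=> Psi; apply/eqP; rewrite -subr_eq0; apply/eqP.
apply: bidual_vanish => [n|i j].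
  rewrite -[LHS]/(biduality (bidual_block Psi) (coordinate n) - Psi (coordinate n)).
  by rewrite biduality_coordinate subrr.
rewrite -[LHS]/(biduality (bidual_block Psi)
  (asym_fun (delta_mx 0 i) (delta_mx 0 j)) - Psi _).
by rewrite biduality_asym_fun dot_delta mx_part_block mxE subrr.
Qed.

Lemma bidualityK : cancel (@biduality R) bidual_block.
Proof.
move=> a; apply: block_ext => [n|]; first exact: biduality_coordinate.
rewrite mx_part_block; apply/matrixP => i j.
by rewrite mxE biduality_asym_fun dot_delta.
Qed.

Lemma bidual_block_linear : linear bidual_block.
Proof.
move=> k Phi Psi; apply: block_ext => [n|].
  by rewrite seq_partD seq_partZ !seq_part_block bop_combE.
rewrite mx_partD mx_partZ !mx_part_block; apply/matrixP => i j.
by rewrite 5!mxE bop_combE.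
Qed.

Lemma rnorm_bidual_block Psi : rnorm (bidual_block Psi) = rnorm Psi.
Proof.
apply/le_anti/andP; split; last first.
  by rewrite -[in leLHS](bidual_blockK Psi) biduality_le.
apply: rnorm_block_le => [|n|]; first exact: rnorm_ge0.
  apply: le_trans (ler_bop _ _) _.
  by rewrite ler_piMr ?rnorm_ge0 ?rnorm_coordinate_le.
move=> u v; rewrite -biduality_asym_fun bidual_blockK.
apply: le_trans (ler_bop _ _) _.
by rewrite ler_wpM2l ?rnorm_ge0 ?rnorm_asym_fun_le.
Qed.

HB.instance Definition _ :=
  GRing.isLinear.Build R[i] (dual (dual X)) A *:%R bidual_block bidual_block_linear.

Lemma bidual_cstar : isometrically_isomorphic (dual (dual X)) A.
Proof.
exists bidual_block; split.
  by exists (@biduality R); [exact: bidual_blockK|exact: bidualityK].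
by move=> Psi; rewrite -!rnormE rnorm_bidual_block.
Qed.

End bidual.

(** * Numerical indices *)

Section numerical_radius.
Context {R : realType} {V : normedModType R[i]}.
Local Notation C := R[i]^o.
Implicit Types (T : bop V V) (x : V) (f : dual V).

Lemma norming_vector (W : normedModType R[i]) (T : bop V W) (c : R) :
  c < rnorm T -> exists2 x, rnorm x <= 1 & c < rnorm (T x).
Proof.
move=> cT; have [_ [x x1 <-] cx] := sup_gt (opnorm_has_sup T).1 cT.
by exists x.
Qed.

Lemma rnorm1_norm (W : normedModType R[i]) (w : W) : rnorm w = 1 -> `|w| = 1.
Proof. by move=> w1; rewrite -rnormE w1. Qed.

Lemma norm1_rnorm (W : normedModType R[i]) (w : W) : `|w| = 1 -> rnorm w = 1.
Proof. by move=> w1; rewrite /rnorm w1. Qed.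

(** The equality f x = 1 forces both norms to be exactly 1. *)
Lemma numerical_rangeI T x f : rnorm x <= 1 -> rnorm f <= 1 -> f x = 1 ->
  numerical_range T (f (T x)).
Proof.
move=> x1 f1 fx.
have h : 1 <= rnorm f * rnorm x.
  by apply: le_trans (ler_bop f x); rewrite fx rnorm1.
exists x, f; split=> //; apply: rnorm1_norm; apply/le_anti.
  by rewrite x1 (le_trans h)// ler_piMl ?rnorm_ge0.
by rewrite f1 (le_trans h)// ler_piMr ?rnorm_ge0.
Qed.

Lemma numerical_range_le T z : numerical_range T z -> rnorm (z : C) <= rnorm T.
Proof.
move=> [x [f [/norm1_rnorm x1 /norm1_rnorm f1 _ ->]]].
apply: le_trans (ler_bop _ _) _; rewrite f1 mul1r.
by apply: le_trans (ler_bop _ _) _; rewrite x1 mulr1.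
Qed.

Lemma le_numerical_radius T z :
  numerical_range T z -> rnorm (z : C) <= numerical_radius T.
Proof.
move=> Tz; apply: ub_le_sup; last by exists z.
by exists (rnorm T) => _ [w Tw <-]; exact: numerical_range_le.
Qed.

Lemma numerical_radius_le T (M : R) : 0 <= M ->
  (forall z, numerical_range T z -> rnorm (z : C) <= M) -> numerical_radius T <= M.
Proof.
move=> M0 TM; rewrite /numerical_radius.
have [->|/set0P S0] := eqVneq [set rnorm (z : C) | z in numerical_range T] set0.
  (* An empty range gives the default supremum 0, covered by [0 <= M]. *)
  by rewrite sup0.
by apply: ge_sup => // _ [z Tz <-]; exact: TM.
Qed.

Lemma numerical_radius_ge0 T : 0 <= numerical_radius T.
Proof.
rewrite /numerical_radius.
have [->|/set0P[_ [z Tz _]]] := eqVneq [set rnorm (z : C) | z in numerical_range T] set0.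
  by rewrite sup0.
exact: le_trans (rnorm_ge0 (z : C)) (le_numerical_radius Tz).
Qed.

(** The operator [T] witnesses that the infimum is taken over a nonempty set, away from the default
    value of [inf]. *)
Lemma le_numerical_index (c : R) T : rnorm T = 1 ->
  (forall S : bop V V, rnorm S = 1 -> c <= numerical_radius S) ->
  c <= numerical_index V.
Proof.
move=> T1 H; apply: lb_le_inf.
  by exists (numerical_radius T), T => //=; exact: rnorm1_norm.
by move=> _ [S /= /norm1_rnorm S1 <-]; exact: H.
Qed.

Lemma numerical_index_le (c : R) T : rnorm T = 1 -> numerical_radius T <= c ->
  numerical_index V <= c.
Proof.
move=> T1 Tc; apply: le_trans Tc; apply: ge_inf.
  by exists 0 => _ [S _ <-]; exact: numerical_radius_ge0.
by exists T => //=; exact: rnorm1_norm.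
Qed.

Lemma rnorm_eq1 (W : normedModType R[i]) (T : bop V W) x :
  rnorm T <= 1 -> rnorm x <= 1 -> 1 <= rnorm (T x) -> rnorm T = 1.
Proof.
move=> T1 x1 Tx; apply/le_anti; rewrite T1 (le_trans Tx)//.
by apply: le_trans (ler_bop _ _) _; rewrite ler_piMr ?rnorm_ge0.
Qed.

End numerical_radius.

(** * The numerical index of X *)

Section index_X.
Context {R : realType}.
Local Notation C := R[i]^o.
Local Notation X := (uspace (@Xsub R)).

Lemma unit_seqE n m : @unit_seq R n m = (m == n)%:R.
Proof. by []. Qed.

Lemma rnorm_bool (b : bool) : rnorm (b%:R : C) = b%:R.
Proof. by case: b; rewrite ?rnorm1 ?rnorm0. Qed.

Lemma rnorm_unit_seq_le n : rnorm (@unit_seq R n) <= 1.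
Proof. by apply: rnorm_ufun_le => m; rewrite unit_seqE rnorm_bool lern1 leq_b1. Qed.

Lemma id_linear : linear (id : X -> X). Proof. by []. Qed.

Lemma id_le (x : X) : rnorm x <= 1 * rnorm x. Proof. by rewrite mul1r. Qed.

Definition id_op : bop X X := bounded_op id_linear id_le.

Lemma rnorm_id_op : rnorm id_op = 1.
Proof.
apply: (@rnorm_eq1 _ _ _ _ (unit_seq 0)).
- exact: rnorm_bounded_op.
- exact: rnorm_unit_seq_le.
- by apply: le_trans (ler_ufun _ 0%N); rewrite /= rnorm1.
Qed.

Lemma numerical_index_X : numerical_index X = 1.
Proof.
apply/le_anti/andP; split.
  apply: (numerical_index_le rnorm_id_op).
  apply: numerical_radius_le => // z /numerical_range_le.
  by rewrite rnorm_id_op.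
apply: (le_numerical_index rnorm_id_op) => T T1.
apply/ler_addgt0Pr => e e0; rewrite -lerBlDr.
have [x x1 Tx] : exists2 x, rnorm x <= 1 & 1 - e < rnorm (T x).
  by apply: norming_vector; rewrite T1 ltrBlDr ltrDl.
have [_ [n _ <-] Txn] := sup_gt (unorm_has_sup (T x)).1 Tx.
(* Coordinate n is erased here and set to the unimodular [l] in [y]; [l] is chosen so that the two
   contributions to the n-th coordinate of [T y] add up in modulus. *)
pose y0 : X := x - (x n : R[i]) *: unit_seq n.
pose t : C := T (unit_seq n) n.
have TxE : T x n = (T y0 n : C) + x n * t.
  by rewrite /y0 bopB bopZ ufunB ufunZ subrK.
have [l l1 lE] := phase_align (T y0 n) t.
pose y : X := y0 + (l : R[i]) *: unit_seq n.
have TyE : T y n = (T y0 n : C) + l * t by rewrite /y bopD bopZ ufunD ufunZ.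
have yn : y n = l.
  by rewrite /y /y0 ufunD ufunB !ufunZ unit_seqE eqxx !mulr1 subrr add0r.
have y1 : rnorm y <= 1.
  apply: rnorm_ufun_le => m; have [->|mn] := eqVneq m n; first by rewrite yn l1.
  rewrite /y /y0 ufunD ufunB !ufunZ unit_seqE (negPf mn) !mulr0 subr0 addr0.
  exact: le_trans (ler_ufun _ _) x1.
pose f : dual X := (l^*%C : R[i]) *: coordinate n.
have f1 : rnorm f <= 1.
  by rewrite rnormZ rnorm_conj l1 mul1r rnorm_coordinate_le.
have fE (w : X) : f w = l^*%C * w n by [].
have fy : f y = 1.
  by rewrite fE yn mulrC mulc_conj l1 expr1n.
have := le_numerical_radius (numerical_rangeI T y1 f1 fy).
apply: le_trans; rewrite fE rnormM rnorm_conj l1 mul1r TyE lE.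
(* Since |x n| <= 1, replacing it with [l] has not decreased the modulus. *)
apply: le_trans (ltW Txn) _; rewrite TxE.
apply: le_trans (ler_rnormD _ _) _; rewrite lerD2l rnormM.
by rewrite ler_piMl ?rnorm_ge0// (le_trans (ler_ufun _ _) x1).
Qed.

End index_X.

(** * The upper bound for the index of the dual *)

Section index_dual_upper.
Context {R : realType}.
Local Notation C := R[i]^o.
Local Notation X := (uspace (@Xsub R)).
Local Notation A := (uspace (@Asub R)).
Local Notation N := (@shift_mx R).
Implicit Types (x y : X) (a c : A) (f : dual X) (B : 'M[R[i]]_2).

Lemma seq_part_mx_block B n : seq_part (mx_block B) n = 0.
Proof. by []. Qed.

Lemma rnorm_mx_block_le B (M : R) : 0 <= M -> mxle B M -> rnorm (mx_block B) <= M.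
Proof.
move=> M0 BM; apply: rnorm_block_le => // [n|].
  by rewrite seq_part_mx_block rnorm0.
by rewrite mx_part_block.
Qed.

Lemma mxle_shift_mx : mxle N 1.
Proof.
apply/mxleP => // u; rewrite mul1r.
have -> : u *m N = u 0 0 *: delta_mx 0 1.
  apply/rowP => j; rewrite !mxE (bigD1 0)//= big1 => [|k k0]; rewrite !mxE ?eqxx /= ?addr0//.
  by rewrite (negPf k0) mulr0.
by rewrite vnormZ vnorm_delta mulr1 rnorm_coord.
Qed.

(** The transpose of left multiplication by N on the matrix part, annihilating the l^1 part. *)
Definition shift_fun f x : C := biduality (mx_block (N *m asymptote x)) f.

Lemma shift_fun_linear f : linear (shift_fun f).
Proof.
move=> k x y; rewrite /shift_fun asymptote_lin mulmxDr -scalemxAr.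
exact: biduality_mx_linear.
Qed.

Lemma shift_fun_le f x : rnorm (shift_fun f x) <= rnorm f * rnorm x.
Proof.
apply: le_trans (biduality_fun_le _ _) _; rewrite mulrC ler_wpM2l ?rnorm_ge0//.
apply: rnorm_mx_block_le; first exact: rnorm_ge0.
rewrite -[rnorm x]mul1r; apply: mxleM => //; first exact: rnorm_ge0.
  exact: mxle_shift_mx.
exact: asymptote_le.
Qed.

Definition shift_bop f : dual X := bounded_op (@shift_fun_linear f) (shift_fun_le f).

Lemma shift_bop_linear : linear (shift_bop : dual X -> dual X).
Proof. by move=> k f g; apply: bop_ext => x; exact: biduality_fun_linear. Qed.

Lemma shift_bop_le f : rnorm (shift_bop f) <= 1 * rnorm f.
Proof. by rewrite mul1r; apply: rnorm_bounded_op; exact: rnorm_ge0. Qed.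

Definition shift_op : bop (dual X) (dual X) := bounded_op shift_bop_linear shift_bop_le.

Lemma shift_opE f x : shift_op f x = biduality (mx_block (N *m asymptote x)) f.
Proof. by []. Qed.

Lemma biduality_shift_op a f :
  biduality a (shift_op f) = biduality (mx_block (N *m mx_part a)) f.
Proof.
apply: biduality_eq; apply: cvg_near_cst; apply: nearW => M.
by rewrite shift_opE asymptote_splice.
Qed.

(** The norm is attained at the (0, 1) matrix coefficient, tested on an element of X whose asymptote
    is the identity. *)
Lemma rnorm_shift_op : rnorm shift_op = 1.
Proof.
pose f : dual X := asym_fun (delta_mx 0 0) (delta_mx 0 1).
pose x : X := splice 0 (mx_block 1%:M).
have x1 : rnorm x <= 1.
  apply: le_trans (splice_le _ _) _; apply: rnorm_mx_block_le => // u v.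
  by rewrite mulmx1 mul1r cauchy_schwarz.
apply: (@rnorm_eq1 _ _ _ _ f).
- exact: rnorm_bounded_op.
- by apply: le_trans (rnorm_asym_fun_le _ _) _; rewrite !vnorm_delta mulr1.
have fx : shift_op f x = 1.
  rewrite shift_opE asymptote_splice mx_part_block mulmx1 biduality_asym_fun.
  by rewrite mx_part_block dot_delta mxE.
have := ler_bop (shift_op f) x; rewrite fx rnorm1 => /le_trans; apply.
by rewrite ler_piMr ?rnorm_ge0.
Qed.

(** Let [a] represent the norm-one functional Psi with Psi f = 1, and let w be the value in the
    numerical range. For a suitable unimodular l, a + s l N a takes the value 1 + s |w| at [f],
    while its norm is at most 1 + s/2 + s^2/2. Hence |w| <= 1/2 + s/2 for every s > 0. *)
Lemma numerical_radius_shift_op : numerical_radius shift_op <= 1 / 2.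
Proof.
apply: numerical_radius_le; first by rewrite divr_ge0.
move=> z [f [Psi [/norm1_rnorm f1 /norm1_rnorm P1 Pf ->]]].
pose a := bidual_block Psi.
have a1 : rnorm a = 1 by rewrite rnorm_bidual_block.
have PE g : Psi g = biduality a g by rewrite bidual_blockK.
have B1 : mxle (mx_part a) 1 by rewrite -a1; exact: mx_part_le.
rewrite PE biduality_shift_op; rewrite PE in Pf.
set w : C := biduality _ f.
have main (s : R) : 0 < s -> rnorm w <= 1 / 2 + s / 2.
  move=> s0.
  pose c := (s%:C * phase w : R[i]) *: mx_block (N *m mx_part a) + a.
  have K0 : 1 <= 1 + s / 2 + s ^+ 2 / 2.
    by rewrite -addrA lerDl addr_ge0 ?divr_ge0 ?sqr_ge0 ?ltW.
  have cle : rnorm c <= 1 + s / 2 + s ^+ 2 / 2.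
    apply: rnorm_block_le => [|n|].
    - exact: le_trans K0.
    - rewrite seq_partD seq_partZ seq_part_mx_block mulr0 add0r.
      by apply: le_trans K0; rewrite -a1 seq_part_le.
    rewrite mx_partD mx_partZ mx_part_block addrC.
    by apply: mxle_shift => //; [exact: rnorm_phase|exact: ltW].
  have cE : biduality c f = (1 + s * rnorm w)%:C.
    rewrite [LHS]biduality_linl -/w -[biduality_fun a f]/(biduality a f) Pf.
    by rewrite -mulrA phaseM -rmorphM addrC rmorphD.
  have := le_trans (ler_bop (biduality c) f)
    (ler_wpM2r (rnorm_ge0 f) (le_trans (biduality_le c) cle)).
  rewrite f1 mulr1 cE rnorm_real ger0_norm; last first.
    by rewrite addr_ge0// mulr_ge0 ?rnorm_ge0 ?ltW.
  rewrite -addrA lerD2l => h; rewrite -(ler_pM2l s0); apply: le_trans h _.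
  by rewrite mulrDr expr2 !mulrA mulr1.
apply/ler_addgt0Pr => e e0.
have e20 : 0 < e * 2 by rewrite mulr_gt0.
by have := main _ e20; rewrite [e * 2 / 2]mulfK// pnatr_eq0.
Qed.

End index_dual_upper.

(** * The lower bound for the index of the dual *)

Section index_dual_lower.
Context {R : realType}.
Local Notation C := R[i]^o.
Local Notation X := (uspace (@Xsub R)).
Local Notation A := (uspace (@Asub R)).
Implicit Types (x y : X) (a c : A) (f h : dual X) (U B : 'M[R[i]]_2).

Lemma vnorm_unitary (w : 'rV[R[i]]_2) U : U \is unitarymx -> vnorm (w *m U) = vnorm w.
Proof.
move=> /unitarymxP UU; apply/eqP; rewrite -(@eqrXn2 _ 2) ?vnorm_ge0//.
apply/eqP/complexI; rewrite -(dotuu (w *m U)) -(dotuu w) dot_mulmx.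
by rewrite -mulmxA UU mulmx1.
Qed.

Definition phase_seq h (n : nat) : C := phase (h (unit_seq n)).

Lemma phase_seq_bounded h : exists M : R, forall n, rnorm (phase_seq h n) <= M.
Proof. by exists 1 => n; rewrite rnorm_phase. Qed.

Definition phase_block h U : A := block U (phase_seq_bounded h).

Lemma phase_block_le h U : U \is unitarymx -> rnorm (phase_block h U) <= 1.
Proof.
move=> Uu; apply: rnorm_block_le => // [n|].
  by rewrite seq_part_block rnorm_phase.
by rewrite mx_part_block; apply/mxleP => // u; rewrite vnorm_unitary// mul1r.
Qed.

(** The phases turn the l^1 part of [h] into its norm [rho], and [unitary_maximizer] treats the
    matrix part. Both values are real and nonnegative, so they add without cancellation and dominate
    |h x|. *)
Lemma unitary_block_maximizer h x : rnorm x <= 1 ->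
  exists2 U, U \is unitarymx &
    rnorm (h x) <= rnorm (biduality (phase_block h U) h).
Proof.
move=> x1.
have Bx : mxle (asymptote x) 1 by apply: mxle_trans x1 (asymptote_le x).
have [U [r [Uu gU gx]]] := unitary_maximizer (biduality_mx_linear h) Bx.
exists U => //.
pose rho := limn (series (fun n => rnorm (h (unit_seq n)))).
have cr := @cvg_unit_seq R h.
have rhole N : \sum_(0 <= n < N) rnorm (h (unit_seq n)) <= rho.
  apply: (@nondecreasing_cvgn_le _ (series (fun n => rnorm (h (unit_seq n))))) => //.
  by apply: nondecreasing_series => n _ _; exact: rnorm_ge0.
have rho0 : 0 <= rho by have := rhole 0; rewrite big_geq.
have E1 : biduality (block 0 (phase_seq_bounded h)) h = rho%:C.
  apply: biduality_eq; apply/cvg_rnormP => e e0.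
  have /cvgrPdist_le/(_ e e0) := cr; apply: filterS => N.
  rewrite splice_sum0; under [in X in _ -> X]eq_bigr do rewrite phaseM.
  by rewrite -rmorph_sum -rmorphB rnorm_real.
have E2 : rnorm (biduality (block 0 (ufun_bounded x)) h) <= rho.
  apply: (cvg_rnorm_le (@biduality_cvg R _ h)) => N.
  rewrite splice_sum0; apply: le_trans (ler_rnorm_sum _ _ _) _.
  apply: le_trans (rhole N); apply: ler_sum => n _.
  by rewrite rnormM ler_piMl ?rnorm_ge0// (le_trans (ler_ufun _ _) x1).
have r0 : 0 <= r by exact: le_trans (rnorm_ge0 _) gx.
rewrite -(biduality_embed x h) (biduality_block_split (asymptote x)).
rewrite [in leRHS](biduality_block_split U) E1 gU -rmorphD rnorm_real.
rewrite ger0_norm ?addr_ge0//.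
by apply: le_trans (ler_rnormD _ _) _; exact: lerD.
Qed.

Section precomp.
Variables (Psi : dual (dual X)) (S : bop (dual X) (dual X)).

Lemma precomp_linear : linear (fun f => Psi (S f) : C).
Proof. by move=> k f g; rewrite bopP bopP. Qed.

Lemma precomp_le f : rnorm (Psi (S f)) <= rnorm Psi * rnorm S * rnorm f.
Proof.
apply: le_trans (ler_bop _ _) _; rewrite -mulrA ler_wpM2l ?rnorm_ge0//.
exact: ler_bop.
Qed.

Definition precomp : dual (dual X) := bounded_op precomp_linear precomp_le.
End precomp.

Lemma numerical_radius_dual (S : bop (dual X) (dual X)) : rnorm S = 1 ->
  1 / 2 <= numerical_radius S.
Proof.
move=> S1; set c := numerical_radius S.
have c0 : 0 <= c by exact: numerical_radius_ge0.
rewrite leNgt; apply/negP => c12.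
(* The midpoint of 2c and 1: [S] exceeds it somewhere on the unit ball, which forces |b| > t > 2c,
   against the bound |b| <= 2c proved below. *)
pose t := (2 * c + 1) / 2.
have t1 : t < rnorm S by rewrite S1 /t; lra.
have tc : 2 * c < t by rewrite /t; lra.
have [f f1 tf] := norming_vector t1.
have [x x1 tx] := norming_vector tf.
have [U Uu hU] := unitary_block_maximizer (S f) x1.
pose a := phase_block (S f) U.
have a1 : rnorm (biduality a) <= 1.
  exact: le_trans (biduality_le _) (phase_block_le _ Uu).
pose b := bidual_block (precomp (biduality a) S).
have bE g : biduality b g = biduality a (S g).
  by rewrite /b bidual_blockK.
have tb : t < rnorm b.
  apply: lt_le_trans (lt_le_trans tx hU) _; rewrite -/a -bE.
  apply: le_trans (biduality_fun_le _ _) _.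
  by rewrite ler_piMr ?rnorm_ge0.
(* Each such [g] is normed by [a], so the value of [b] at [g] lies in the numerical range of [S]. *)
have rad g : rnorm g <= 1 -> biduality a g = 1 -> rnorm (biduality b g : C) <= c.
  by move=> g1 ag; rewrite bE; apply/le_numerical_radius/numerical_rangeI.
suff : rnorm b <= 2 * c by move=> /(lt_le_trans tb); rewrite ltNge ltW.
apply: rnorm_block_le => [|n|].
- by rewrite mulr_ge0.
- apply: (@le_trans _ _ c); last by lra.
  pose p := phase_seq (S f) n.
  have pn : rnorm p = 1 by exact: rnorm_phase.
  have := rad ((p^*%C : R[i]) *: coordinate n); rewrite !bopZ !biduality_coordinate.
  rewrite rnormZ rnorm_conj pn mul1r; move=> /(_ (rnorm_coordinate_le n)).
  rewrite seq_part_block -[_ *: phase_seq _ _]/(p^*%C * p) mulrC mulc_conj pn expr1n.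
  by move=> /(_ erefl); rewrite rnormZ rnorm_conj pn mul1r.
(* The vector state of w rotated by U, scaled by |w|^-2, has norm at most 1 and takes the value 1 at
   [a]. *)
have H w : rnorm (dot (w *m mx_part b) (w *m U)) <= c * vnorm w ^+ 2.
  have [->|w0] := eqVneq w 0.
    by rewrite mul0mx dot0l rnorm0 mulr_ge0 ?sqr_ge0.
  have wn : 0 < vnorm w by rewrite vnorm_gt0.
  pose k : R[i] := ((vnorm w)^-2)%:C.
  have kn : rnorm (k : C) = (vnorm w)^-2.
    by rewrite rnorm_real ger0_norm// invr_ge0 sqr_ge0.
  have := rad (k *: asym_fun w (w *m U)).
  rewrite !bopZ !biduality_asym_fun mx_part_block !rnormZ kn.
  have h1 : (vnorm w)^-2 * rnorm (asym_fun w (w *m U)) <= 1.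
    rewrite ler_pdivrMl ?exprn_gt0// mulr1.
    apply: le_trans (rnorm_asym_fun_le _ _) _.
    by rewrite vnorm_unitary// expr2.
  have h2 : k *: dot (w *m U) (w *m U) = 1.
    rewrite dotuu vnorm_unitary// -[LHS]/(k * _) -rmorphM mulVf ?rmorph1//.
    by rewrite expf_neq0// gt_eqF.
  by move=> /(_ h1 h2); rewrite ler_pdivrMl ?exprn_gt0// mulrC.
move=> u v.
(* The second vector is rotated back, so that the factor [U] in [H] cancels. *)
have := polarization H u (v *m (U^t* )).
have -> : v *m (U^t* ) *m U = v.
  by rewrite -(invmx_unitary Uu) mulmxKV// unitarymx_unit.
have Usu : (U^t* ) \is unitarymx by rewrite trmxC_unitary.
by rewrite (vnorm_unitary v Usu).
Qed.

Lemma numerical_index_dual_X : numerical_index (dual X) = 1 / 2.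
Proof.
apply/le_anti/andP; split.
  exact: numerical_index_le rnorm_shift_op numerical_radius_shift_op.
exact: le_numerical_index rnorm_shift_op numerical_radius_dual.
Qed.

End index_dual_lower.

Theorem mainTheorem4 (R : realType) :
  exists X : completeNormedModType R[i],
    (exists A : cstarAlgebraType R,
        isometrically_isomorphic (dual (dual X)) A) /\
    numerical_index X = 1 /\
    numerical_index (dual X) = 1 / 2.
Proof.
exists (uspace (@Xsub R)); split; last first.
  by split; [exact: numerical_index_X|exact: numerical_index_dual_X].
by exists (uspace (@Asub R)); exact: bidual_cstar.
Qed.
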